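(* Let $a_1,a_2,\dots,a_N$ be self-adjoint elements in a $C^*$-probability space $(\mathcal{A},\varphi)$, and let $\lambda>0$. If $(a_1,\dots,a_N)$ has an almost sure random matrix model, then there are a subsequence $\alpha(n)$ of the natural numbers and a sequence $\{Y(n,i):i=1,2,\dots,N\}$, $n=1,2,\dots$, of families of $\alpha(n)\times\alpha(n)$ random matrices which, as $n\to\infty$, converges in distribution to the multidimensional compound free Poisson distribution determined by $\lambda$ and the distribution of $\{a_i\}_{i=1}^N$.
   Context: A $C^*$-probability space $(\mathcal{A},\varphi)$ is a unital $C^*$-algebra with a state. For a probability space $(\Omega,P)$, $L^{\infty-}(\Omega,P)=\bigcap_{p\ge1}L^p(\Omega,P)$ and $E$ is the expectation; $n\times n$ random matrices are viewed in the non-commutative probability space $(M_n(L^{\infty-}(\Omega,P)),E\circ tr)$, where $tr$ (or $tr_n$) is the normalized trace. Convergence in distribution of tuples means convergence of all joint moments (values of the functional on all non-commutative monomials). Almost sure random matrix model. A sequence of $N$-tuples $\{X(1,n),\dots,X(N,n)\}$ of $n\times n$ random matrices on a probability space $(\Omega,P)$, $n=1,2,\dots$, is an almost sure random matrix model of $(a_1,\dots,a_N)$ if for almost all $\omega\in\Omega$, the tuple $\{X(1,n,\omega),\dots,X(N,n,\omega)\}\subset(M_n(\mathbb{C}),tr_n)$ converges in distribution to $(a_1,\dots,a_N)$ as $n\to\infty$. Multidimensional compound free Poisson distribution. It is the joint distribution of a tuple $(y_1,\dots,y_N)$ in a non-commutative probability space whose free cumulants $\kappa_m$ satisfy $\kappa_m(y_{\chi(1)},\dots,y_{\chi(m)})=\lambda\,\varphi(a_{\chi(1)}\cdots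 a_{\chi(m)})$ for all $m\in\mathbb{N}$ and all $\chi:\{1,\dots,m\}\to\{1,\dots,N\}$. Here the free cumulants are determined by $\psi(b_1\cdots b_m)=\sum_{\pi\in NC(m)}\prod_{V\in\pi}\kappa_{|V|}((b_1,\dots,b_m)|_V)$, where $\psi$ is the functional of the space, $NC(m)$ is the set of non-crossing partitions of $\{1,\dots,m\}$, and $(b_1,\dots,b_m)|_V$ lists the $b_k$, $k\in V$, in increasing order of $k$. *)

(* Defs.v *)
From HB Require Import structures.
From mathcomp Require Import all_boot all_order all_algebra.
From mathcomp Require Import complex.
From mathcomp Require Import all_classical all_reals all_analysis.

Set Implicit Arguments.
Unset Strict Implicit.
Unset Printing Implicit Defensive.

Import Order.TTheory GRing.Theory Num.Theory.
Import numFieldNormedType.Exports.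
Local Open Scope classical_set_scope.
Local Open Scope complex_scope.
Local Open Scope ring_scope.

(* The norm is a field of the mixin because the hierarchy has no join of the
   ring and the normed module structures over a common carrier.
   A GRing.Algebra is nontrivial, as is any algebra carrying a state. *)
HB.mixin Record isCStarAlgebra (R : realType) A & GRing.Algebra R[i] A := {
  star : A -> A;
  cnorm : A -> R;
  starK : involutive star;
  starD : {morph star : x y / x + y};
  starZ : forall (c : R[i]) x, star (c *: x) = c^* *: star x;
  starM : forall x y, star (x * y) = star y * star x;
  cnorm_eq0 : forall x, cnorm x = 0 -> x = 0;
  cnormD_le : forall x y, cnorm (x + y) <= cnorm x + cnorm y;
  cnormZ : forall (c : R[i]) x,
    cnorm (c *: x) = ComplexField.Normc.normc c * cnorm x;
  cnormM_le : forall x y, cnorm (x * y) <= cnorm x * cnorm y;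
  cnorm_starM : forall x, cnorm (star x * x) = cnorm x ^+ 2;
  cnorm_complete : forall u : nat -> A,
    (forall e : R, 0 < e -> exists n0 : nat,
       forall m n, (n0 <= m)%N -> (n0 <= n)%N -> cnorm (u m - u n) < e) ->
    exists x : A, cnorm (u n - x) @[n --> \oo] --> (0 : R)
}.

#[short(type="cstarAlgType")]
HB.structure Definition CStarAlgebra (R : realType) :=
  {A of isCStarAlgebra R A & GRing.Algebra R[i] A}.

Definition self_adjoint (R : realType) (A : cstarAlgType R) (x : A) : Prop :=
  star x = x.

Definition is_state (R : realType) (A : cstarAlgType R)
    (phi : {scalar A}) : Prop :=
  phi 1 = 1 /\ forall x : A, 0 <= phi (star x * x).

(* The distribution of an N-tuple is encoded by its joint moments: a function
   on words in the letters 0, ..., N-1. *)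
Definition moment (C : Type) (N : nat) (B : pzRingType) (phi : B -> C)
    (b : 'I_N -> B) (w : seq 'I_N) : C :=
  phi (\prod_(i <- w) b i).

(* R[i]^o is R[i] with the topology of its modulus. *)
Definition cvg_in_distribution (R : realType) (N : nat)
    (mu_ : nat -> seq 'I_N -> R[i]) (mu : seq 'I_N -> R[i]) : Prop :=
  forall w, (mu_ n w : R[i]^o) @[n --> \oo] --> (mu w : R[i]^o).

Definition normalized_trace (R : realType) (n : nat) (A : 'M[R[i]]_n) : R[i] :=
  \tr A / n%:R.

Section RandomMatrices.
Context (R : realType) (d : measure_display) (Omega : measurableType d).
Variable P : probability Omega R.

(* Membership in every L^p, 1 <= p < oo; being in Lfun includes the
   measurability and the p-integrability of the modulus. *)
Definition in_Linfty_minus (f : Omega -> R[i]) : Prop :=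
  [/\ measurable_fun setT (fun omega => complex.Re (f omega)),
      measurable_fun setT (fun omega => complex.Im (f omega)) &
      forall p : R, 1 <= p ->
        (fun omega => ComplexField.Normc.normc (f omega)) \in Lfun P p%:E].

Definition cexpectation (f : Omega -> R[i]) : R[i] :=
  (\int[P]_omega complex.Re (f omega)) +i* (\int[P]_omega complex.Im (f omega)).

Definition random_matrix (n : nat) (X : Omega -> 'M[R[i]]_n) : Prop :=
  forall i j, in_Linfty_minus (fun omega => X omega i j).

(* The functional E o tr_n, on the (pointwise) ring Omega -> 'M_n. *)
Definition expected_trace (n : nat) (X : Omega -> 'M[R[i]]_n) : R[i] :=
  cexpectation (fun omega => normalized_trace (X omega)).

(* Matrices of size n = 1, 2, ... are indexed by n.+1. *)
Definition almost_sure_model (N : nat)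
    (X : forall n : nat, 'I_N -> Omega -> 'M[R[i]]_n.+1)
    (mu : seq 'I_N -> R[i]) : Prop :=
  (forall n i, random_matrix (X n i)) /\
  {ae P, forall omega,
     cvg_in_distribution
       (fun n => moment (@normalized_trace R n.+1) (fun i => X n i omega)) mu}.

End RandomMatrices.

Definition noncrossing (m : nat) (pi : {set {set 'I_m}}) : bool :=
  [forall V in pi, forall W in pi, (V != W) ==>
   ~~ [exists i in V, exists j in W, exists k in V, exists l in W,
        [&& (i < j)%N, (j < k)%N & (k < l)%N]]].

Definition noncrossing_partitions (m : nat) : {set {set {set 'I_m}}} :=
  [set pi : {set {set 'I_m}} | finset.partition pi [set: 'I_m] & noncrossing pi]%SET.

Section FreeProbability.
Variable R : realType.

(* kappa s stands for kappa_m(s_1, ..., s_m) with m = size s; the enumeration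
   of a set V : {set 'I_m} is increasing. *)
Definition is_free_cumulants (B : algType R[i]) (psi : B -> R[i])
    (kappa : seq B -> R[i]) : Prop :=
  forall (m : nat) (b : m.-tuple B), (0 < m)%N ->
    psi (\prod_(k < m) tnth b k) =
    \sum_(pi in noncrossing_partitions m)
      \prod_(V in pi) kappa [seq tnth b k | k <- enum V].

(* nu is the multidimensional compound free Poisson distribution determined by
   lambda and the distribution mu. *)
Definition compound_free_poisson (N : nat) (lambda : R)
    (mu nu : seq 'I_N -> R[i]) : Prop :=
  exists (B : algType R[i]) (psi : {scalar B}) (kappa : seq B -> R[i])
         (y : 'I_N -> B),
    [/\ psi 1 = 1,
        is_free_cumulants psi kappa,
        forall chi : seq 'I_N, (0 < size chi)%N ->
          kappa [seq y i | i <- chi] = lambda%:C * mu chi &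
        forall w, nu w = moment psi y w].

End FreeProbability.

(* Main.v *)
Require Import Defs.
From HB Require Import structures.
From mathcomp Require Import all_boot all_order all_algebra.
From mathcomp Require Import complex zify.
From mathcomp Require Import all_classical all_reals all_analysis.
From mathcomp Require cyclic separable cyclotomic monalg mpoly.

Set Implicit Arguments.
Unset Strict Implicit.
Unset Printing Implicit Defensive.

Import Order.TTheory GRing.Theory Num.Theory.
Import numFieldNormedType.Exports.
Local Open Scope ring_scope.

(** The matrices can be taken deterministic.  Along one trajectory of the given
    model all moments converge, which supplies matrices D_i of size n+1 whose
    normalized traces tend to the moments of the a_i; in particular these
    moments are invariant under cyclic rotation of words.  With (n+1)/r tending
    to lambda, the candidates are the Wishart-type matrices C' D_i C / r, where
    C is an (n+1) x r matrix of independent standard complex Gaussian variables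
    and C' its adjoint.

    Why they have the right limit.  Take the Gaussian expectation of a product
    of normalized traces of words in these matrices and integrate by parts with
    respect to the first entry of C'.  Contracting it with an entry of C in the
    same word cuts that word in two; contracting it with an entry of another
    word merges the two words, at the price of a factor 1/r^2 (loop_equation).
    As n grows the merging terms disappear, so the expectation becomes
    multiplicative over the words and satisfies the recursion
    poisson_moment_cons, whose solution is unique (loop_limit).

    The moments of the compound free Poisson law satisfy the same recursion.  In
    a non-crossing partition let v be the last element of the block of the first
    element: the partition splits at v, and, because the cumulants lambda phi
    are cyclically invariant, the first letter may be absorbed into the letter
    in position v, on its right (ncsum_rec, nc_moment_poisson).  An algebra
    with these moments is the free algebra, and its free cumulants exist and are
    determined by its moments (cumulant_exists, cumulant_unique).

    Why randomness can be removed.  For words of bounded length only finitely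
    many Gaussian moments matter, and these are reproduced exactly by the uniform
    measure on a finite set of points at which the entries of C' and C take
    complex values that need not be conjugate (gaussian_quadrature).  An average
    of normalized traces over a finite set is the normalized trace of a direct
    sum, and repeating the summands makes the sizes strictly increasing
    (poisson_matrix_model). *)

(** * Sums over non-crossing partitions *)

Lemma set_partitionP (T : finType) (pi : {set {set T}}) (S : {set T}) :
  reflect [/\ forall V, V \in pi -> V != finset.set0,
              forall V x, V \in pi -> x \in V -> x \in S,
              forall x, x \in S -> exists2 V, V \in pi & x \in V &
              forall V W x, V \in pi -> W \in pi -> x \in V -> x \in W -> V = W]
          (finset.partition pi S).
Proof.
apply: (iffP idP) => [/and3P[/eqP covS triv n0]|[ne sub ex un]].
  split => [V Vpi|V x Vpi xV|x xS|V W x Vpi Wpi xV xW].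
  - by apply: contra n0 => /eqP <-.
  - by rewrite -covS; apply/finset.bigcupP; exists V.
  - by move: xS; rewrite -covS => /finset.bigcupP[V Vpi xV]; exists V.
  - by rewrite -(def_pblock triv Vpi xV) -(def_pblock triv Wpi xW).
apply/and3P; split.
- apply/eqP/finset.setP => x; apply/finset.bigcupP/idP => [[V Vpi xV]|/ex[V]].
    exact: sub xV.
  by exists V.
- apply/finset.trivIsetP => V W Vpi Wpi; apply: contraR => /pred0Pn[x /andP[xV xW]].
  by apply/eqP; apply: un xV xW.
- by apply/negP => /ne; rewrite eqxx.
Qed.

Lemma noncrossingP (m : nat) (pi : {set {set 'I_m}}) :
  reflect (forall V W (i j k l : 'I_m), V \in pi -> W \in pi ->
             i \in V -> j \in W -> k \in V -> l \in W ->
             (i < j)%N -> (j < k)%N -> (k < l)%N -> V = W)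
          (noncrossing pi).
Proof.
apply: (iffP forall_inP) => [nc V W i j k l Vpi Wpi iV jW kV lW ij jk kl|nc V Vpi].
  apply/eqP; apply: contraT => VW.
  have /forall_inP/(_ W Wpi)/implyP/(_ VW)/negP[] := nc V Vpi.
  apply/exists_inP; exists i => //; apply/exists_inP; exists j => //.
  apply/exists_inP; exists k => //; apply/exists_inP; exists l => //.
  by rewrite ij jk.
apply/forall_inP => W Wpi; apply/implyP => VW.
apply: contra VW => /exists_inP[i iV /exists_inP[j jW]].
move=> /exists_inP[k kV /exists_inP[l lW /and3P[ij jk kl]]].
by apply/eqP; apply: (nc V W i j k l).
Qed.

Section NoncrossingSums.
Variables (F : comNzRingType) (n : nat).
Implicit Types (S V W : {set 'I_n}) (pi sigma tau : {set {set 'I_n}}).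
Implicit Types (K : {set 'I_n} -> F).

Definition nc_partitions_of S : {set {set {set 'I_n}}} :=
  [set pi : {set {set 'I_n}} | finset.partition pi S & noncrossing pi]%SET.

Definition ncsum K S : F :=
  \sum_(pi in nc_partitions_of S) \prod_(V in pi) K V.

Lemma nc_partitions_ofP pi S :
  reflect (finset.partition pi S /\ noncrossing pi) (pi \in nc_partitions_of S).
Proof. by rewrite inE; apply: andP. Qed.

Lemma eq_ncsum K K' S :
  (forall V, V \subset S -> K V = K' V) -> ncsum K S = ncsum K' S.
Proof.
move=> eqK; apply: eq_bigr => pi /nc_partitions_ofP[/set_partitionP[_ sub _ _] _].
by apply: eq_bigr => V Vpi; apply: eqK; apply/fintype.subsetP => x; apply: sub.
Qed.

Lemma ncsum0 K : ncsum K finset.set0 = 1.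
Proof.
rewrite /ncsum (big_pred1 finset.set0) ?big_set0 // => pi.
apply/nc_partitions_ofP/eqP => [[]|->].
  by rewrite partition_set0 => /eqP.
rewrite partition_set0 eqxx; split => //.
by apply/noncrossingP => V W i j k l; rewrite inE.
Qed.

Lemma ncsum1 K i : ncsum K [set i]%SET = K [set i]%SET.
Proof.
rewrite /ncsum (big_pred1 [set [set i]]%SET) ?big_set1 // => pi.
apply/nc_partitions_ofP/eqP => [[/set_partitionP[ne sub ex un] _]|->].
  have all1 V : V \in pi -> V = [set i]%SET.
    move=> Vpi; have /finset.set0Pn[x xV] := ne V Vpi.
    apply/finset.setP => y; rewrite inE; apply/idP/eqP => [yV|->].
      by have := sub V y Vpi yV; rewrite inE => /eqP.
    by have := sub V x Vpi xV; rewrite inE => /eqP <-.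
  have [V Vpi _] := ex i (finset.set11 i).
  apply/finset.setP => W; rewrite inE; apply/idP/eqP => [/all1 //|->].
  by rewrite -(all1 V Vpi).
split; last first.
  by apply/noncrossingP => V W a b c d; rewrite !inE => /eqP -> /eqP ->.
apply/set_partitionP; split => [V|V x|x|V W x]; rewrite ?inE.
- by move=> /eqP ->; apply/finset.set0Pn; exists i; rewrite inE.
- by move=> /eqP ->; rewrite inE.
- by move=> /eqP ->; exists [set i]%SET; rewrite inE.
- by move=> /eqP -> /eqP ->.
Qed.

Definition same_block (i v : 'I_n) pi := [exists V in pi, (i \in V) && (v \in V)].

Section Contract.
Variables (K : {set 'I_n} -> F) (S : {set 'I_n}) (i v : 'I_n).
Hypotheses (iS : i \in S) (vS : v \in S) (iv : i != v).
Hypothesis imin : forall x, x \in S -> (i <= x)%N.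
Hypothesis vmax : forall x, x \in S -> (x <= v)%N.

Let add V := if v \in V then (i |: V)%SET else V.

Let addE V : i \notin V -> (add V :\ i)%SET = V.
Proof.
rewrite /add => iV; case: ifP => _; first by rewrite setU1K.
by apply/finset.setDidPl; rewrite disjoint_sym disjoints1.
Qed.

(** Deleting the least element i is a bijection from the non-crossing partitions
    of S in which i and the greatest element v share a block to all non-crossing
    partitions of S minus i: putting i back into the block of v creates no
    crossing, as no element lies outside the interval from i to v. *)
Lemma ncsum_same_block :
  \sum_(pi in nc_partitions_of S | same_block i v pi) \prod_(V in pi) K V =
  ncsum (fun V => K (if v \in V then i |: V else V)%SET) (S :\ i).
Proof.
have noti sigma V : sigma \in nc_partitions_of (S :\ i)%SET -> V \in sigma ->
    i \notin V.
  move=> /nc_partitions_ofP[/set_partitionP[_ sub _ _] _] Vs; apply/negP => iV.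
  by have := sub V i Vs iV; rewrite !inE eqxx.
have addI sigma : sigma \in nc_partitions_of (S :\ i)%SET ->
    {in sigma &, injective add}.
  move=> sS V W Vs Ws eqVW.
  by rewrite -(addE (noti _ _ sS Vs)) -(addE (noti _ _ sS Ws)) eqVW.
transitivity (\sum_(pi in ((fun sigma : {set {set 'I_n}} => add @: sigma)
                          @: nc_partitions_of (S :\ i))%SET)
   \prod_(V in pi) K V).
  apply: eq_bigl => pi.
  apply/andP/imsetP => [[/nc_partitions_ofP[/set_partitionP[ne sub ex un]]]|].
    move=> /noncrossingP nc /exists_inP[B Bpi /andP[iB vB]].
    have addD V : V \in pi -> add (V :\ i)%SET = V.
      move=> Vpi; rewrite /add !inE eq_sym iv /=.
      case: (boolP (i \in V)) => iV.
        by rewrite (un V B i) // vB finset.setD1K.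
      rewrite (_ : v \in V = false); last first.
        by apply: contraNF iV => vV; rewrite (un V B v).
      by apply/finset.setDidPl; rewrite disjoint_sym disjoints1.
    exists [set V :\ i | V : {set 'I_n} in pi]%SET.
      apply/nc_partitions_ofP; split.
        apply/set_partitionP; split.
        - move=> _ /imsetP[V Vpi ->]; apply/finset.set0Pn.
          have /finset.set0Pn[x xV] := ne V Vpi.
          have [xi|xi] := eqVneq x i; last by exists x; rewrite !inE xi.
          exists v; rewrite !inE eq_sym iv /= (un V B i) //.
          by rewrite -xi.
        - move=> _ x /imsetP[V Vpi ->]; rewrite !inE => /andP[-> xV] /=.
          exact: sub xV.
        - move=> x; rewrite !inE => /andP[xi /ex[V Vpi xV]].
          by exists (V :\ i)%SET; [apply/imsetP; exists V|rewrite !inE xi].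
        - move=> _ _ x /imsetP[V Vpi ->] /imsetP[W Wpi ->]; rewrite !inE.
          by move=> /andP[_ xV] /andP[_ xW]; rewrite (un V W x).
      apply/noncrossingP => _ _ a b c d /imsetP[V Vpi ->] /imsetP[W Wpi ->].
      rewrite !inE => /andP[_ aV] /andP[_ bW] /andP[_ cV] /andP[_ dW] ab bc cd.
      by rewrite (nc V W a b c d).
    rewrite -imset_comp; apply/finset.setP => V; apply/idP/imsetP.
      by move=> Vpi; exists V => //=; rewrite addD.
    by move=> [W Wpi ->] /=; rewrite addD.
  move=> [sigma sS ->].
  have [/set_partitionP[ne sub ex un] /noncrossingP nc] := nc_partitions_ofP _ _ sS.
  have subS V x : V \in sigma -> x \in add V -> x \in S.
    move=> Vs; rewrite /add; case: ifP => _; rewrite ?inE.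
      by move=> /orP[/eqP -> //|/(sub V x Vs)]; rewrite !inE => /andP[].
    by move=> /(sub V x Vs); rewrite !inE => /andP[].
  have inadd V x : x != i -> (x \in add V) = (x \in V).
    by rewrite /add => xi; case: ifP; rewrite ?inE ?(negbTE xi).
  have iadd V : V \in sigma -> i \in add V -> v \in V.
    by move=> Vs; rewrite /add; case: ifP => // _ iV; have := noti _ _ sS Vs; rewrite iV.
  have [B Bs vB] : exists2 V, V \in sigma & v \in V.
    by apply: ex; rewrite !inE eq_sym iv.
  split; last first.
    apply/exists_inP; exists (add B); first exact: imset_f.
    by rewrite /add vB !inE eqxx vB orbT.
  apply/nc_partitions_ofP; split.
    apply/set_partitionP; split.
    - move=> _ /imsetP[V Vs ->]; apply/finset.set0Pn.
      have /finset.set0Pn[x xV] := ne V Vs; exists x.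
      by rewrite /add; case: ifP; rewrite ?inE xV ?orbT.
    - by move=> _ x /imsetP[V Vs ->]; apply: subS.
    - move=> x xS; have [->|xi] := eqVneq x i.
        by exists (add B); [exact: imset_f|rewrite /add vB !inE eqxx].
      have [|V Vs xV] := ex x; first by rewrite !inE xi.
      by exists (add V); [exact: imset_f|rewrite inadd].
    - move=> _ _ x /imsetP[V Vs ->] /imsetP[W Ws ->].
      have [->|xi] := eqVneq x i.
        by move=> /(iadd V Vs) vV /(iadd W Ws) vW; rewrite (un V W v).
      by rewrite !inadd // => xV xW; rewrite (un V W x).
  apply/noncrossingP => _ _ a b c d /imsetP[V Vs ->] /imsetP[W Ws ->].
  move=> aV bW cV dW ab bc cd; congr add.
  have ne_i x y : x \in S -> (x < y)%N -> y != i.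
    by move=> xS xy; apply/eqP => yi; have := imin xS; rewrite leqNgt -yi xy.
  have bi := ne_i a b (subS _ _ Vs aV) ab.
  have ci := ne_i b c (subS _ _ Ws bW) bc.
  have di := ne_i c d (subS _ _ Vs cV) cd.
  move: (bW) (cV) (dW); rewrite !inadd // => bW' cV' dW'.
  have [ai|ai] := eqVneq a i; last first.
    by move: aV; rewrite inadd // => aV; apply: (nc V W a b c d).
  (* here a = i, and v stands in for it beyond d *)
  have vV : v \in V by apply: iadd; rewrite // -ai.
  have := vmax (subS _ _ Ws dW); rewrite leq_eqVlt => /orP[/eqP dv|dv].
    by apply: (un V W v) => //; rewrite -(val_inj dv).
  by apply/esym; apply: (nc W V b c d v).
rewrite big_imset /=; last first.
  move=> sigma tau sS tS 
    /(congr1 (fun pi : {set {set 'I_n}} => [set V :\ i | V : {set 'I_n} in pi]%SET)).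
  have addK (sg : {set {set 'I_n}}) : sg \in nc_partitions_of (S :\ i)%SET ->
      [set V :\ i | V : {set 'I_n} in (add @: sg)%SET]%SET = sg.
    move=> sgS; rewrite -imset_comp; apply/finset.setP => V; apply/imsetP/idP.
      by move=> [W Ws ->] /=; rewrite addE // (noti _ _ sgS).
    by move=> Vs; exists V => //=; rewrite addE // (noti _ _ sgS).
  by rewrite !addK.
apply: eq_bigr => sigma sS; rewrite big_imset //=; exact: addI.
Qed.
End Contract.



Definition last_in_block (i v : 'I_n) pi :=
  [exists V in pi, [&& i \in V, v \in V & [forall y in V, (y <= v)%N]]].

Section Split.
Variables (K : {set 'I_n} -> F) (S : {set 'I_n}) (i v : 'I_n).
Hypotheses (iS : i \in S) (vS : v \in S).
Hypothesis imin : forall x, x \in S -> (i <= x)%N.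

Let lo := [set x in S | (x <= v)%N]%SET.
Let hi := [set x in S | (v < x)%N]%SET.

(** When v ends the block of the least element i, every other block lies on one
    side of v, since it would otherwise cross the block of i; the two sides can
    then be partitioned independently. *)
Lemma ncsum_split :
  \sum_(pi in nc_partitions_of S | last_in_block i v pi) \prod_(V in pi) K V =
  (\sum_(pi in nc_partitions_of lo | same_block i v pi) \prod_(V in pi) K V)
  * ncsum K hi.
Proof.
pose A := [set p : {set {set 'I_n}} * {set {set 'I_n}} |
  (p.1 \in nc_partitions_of lo) && same_block i v p.1 & p.2 \in nc_partitions_of hi]%SET.
have sub_lo sg V x : sg \in nc_partitions_of lo -> V \in sg -> x \in V ->
    (x \in S) && (x <= v)%N.
  by move=> /nc_partitions_ofP[/set_partitionP[_ sub _ _] _] Vs /(sub V x Vs); rewrite !inE.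
have sub_hi ta V x : ta \in nc_partitions_of hi -> V \in ta -> x \in V ->
    (x \in S) && (v < x)%N.
  by move=> /nc_partitions_ofP[/set_partitionP[_ sub _ _] _] Vs /(sub V x Vs); rewrite !inE.
have disj sg ta : sg \in nc_partitions_of lo -> ta \in nc_partitions_of hi ->
    forall V, V \in sg -> V \in ta -> False.
  move=> sL tH V Vs Vt.
  have [/set_partitionP[ne _ _ _] _] := nc_partitions_ofP _ _ sL.
  have /finset.set0Pn[x xV] := ne V Vs.
  have /andP[_] := sub_lo _ _ _ sL Vs xV; have /andP[_] := sub_hi _ _ _ tH Vt xV.
  by rewrite ltnNge => /negP.
transitivity (\sum_(pi in (fun p : {set {set 'I_n}} * {set {set 'I_n}} =>
                         (p.1 :|: p.2)%SET) @: A) \prod_(V in pi) K V).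
  apply: eq_bigl => pi; apply/andP/imsetP => [[]|].
    move=> /nc_partitions_ofP[/set_partitionP[ne sub ex un] /noncrossingP nc].
    move=> /exists_inP[B Bpi /and3P[iB vB /forall_inP Bv]].
    (* a block with elements on both sides of v would cross the block of i *)
    have side V x y : V \in pi -> x \in V -> y \in V -> (x <= v)%N -> (y <= v)%N.
      move=> Vpi xV yV; rewrite leq_eqVlt => /orP[/eqP/val_inj xv|xv].
        by apply: Bv; rewrite (un B V v) // -xv.
      rewrite leqNgt; apply/negP => vy.
      have : (i <= x)%N by apply: imin; apply: sub xV.
      rewrite leq_eqVlt => /orP[/eqP/val_inj ix|ix].
        have BV : B = V by apply: (un B V i) => //; rewrite ix.
        by have := Bv y; rewrite BV => /(_ yV); rewrite leqNgt vy.
      have BV : B = V by apply: (nc B V i x v y).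
      by have := Bv y; rewrite BV => /(_ yV); rewrite leqNgt vy.
    have partI (Q : pred 'I_n) :
        (forall V x y, V \in pi -> x \in V -> y \in V -> Q x -> Q y) ->
        [set V in pi | [forall x in V, Q x]]%SET \in
          nc_partitions_of [set x in S | Q x]%SET.
      move=> Qside; apply/nc_partitions_ofP; split; last first.
        apply/noncrossingP => V W a b c d; rewrite !inE => /andP[Vpi _] /andP[Wpi _].
        exact: nc.
      apply/set_partitionP; split.
      - by move=> V; rewrite inE => /andP[/ne].
      - move=> V x; rewrite !inE => /andP[Vpi /forall_inP QV] xV.
        by rewrite (sub V x) //= QV.
      - move=> x; rewrite inE => /andP[/ex[V Vpi xV] Qx]; exists V => //.
        by rewrite inE Vpi; apply/forall_inP => y yV; apply: (Qside V x y).
      - by move=> V W x; rewrite !inE => /andP[Vpi _] /andP[Wpi _]; apply: un.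
    exists ([set V in pi | [forall x in V, (x <= v)%N]]%SET,
            [set V in pi | [forall x in V, (v < x)%N]]%SET).
      rewrite inE /= -andbA; apply/and3P; split.
      - by apply: (partI (fun x => (x <= v)%N)) => V x y; apply: side.
      - apply/exists_inP; exists B; last by rewrite iB vB.
        by rewrite inE Bpi; apply/forall_inP.
      - apply: (partI (fun x => (v < x)%N)) => V x y Vpi xV yV.
        by rewrite !ltnNge; apply: contra; apply: side yV xV.
    apply/finset.setP => V; rewrite !inE -andb_orr.
    case: (boolP (V \in pi)) => //= Vpi; apply/esym.
    have /finset.set0Pn[x xV] := ne V Vpi.
    case: (leqP x v) => xv; apply/orP; [left|right]; apply/forall_inP => y yV.
      exact: side xV yV xv.
    by rewrite ltnNge; apply/negP => yv; have := side V y x Vpi yV xV yv; rewrite leqNgt xv.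
  move=> [[sg ta]]; rewrite inE /= => /andP[/andP[sL /exists_inP[B Bs /andP[iB vB]]] tH] ->.
  have [/set_partitionP[sne ssub sex sun] /noncrossingP snc] := nc_partitions_ofP _ _ sL.
  have [/set_partitionP[tne tsub tex tun] /noncrossingP tnc] := nc_partitions_ofP _ _ tH.
  have lohi V W x : V \in sg -> W \in ta -> x \in V -> x \in W -> False.
    move=> Vs Wt xV xW.
    have /andP[_] := sub_lo _ _ _ sL Vs xV; have /andP[_] := sub_hi _ _ _ tH Wt xW.
    by rewrite ltnNge => /negP.
  split; last first.
    apply/exists_inP; exists B; first by rewrite inE Bs.
    rewrite iB vB; apply/forall_inP => y yB.
    by have /andP[] := sub_lo _ _ _ sL Bs yB.
  apply/nc_partitions_ofP; split.
    apply/set_partitionP; split.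
    - by move=> V; rewrite inE => /orP[/sne|/tne].
    - move=> V x; rewrite inE => /orP[Vs|Vt] xV.
        by have /andP[] := sub_lo _ _ _ sL Vs xV.
      by have /andP[] := sub_hi _ _ _ tH Vt xV.
    - move=> x xS; case: (leqP x v) => xv.
        have [|V Vs xV] := sex x; first by rewrite inE xS.
        by exists V => //; rewrite inE Vs.
      have [|V Vs xV] := tex x; first by rewrite inE xS.
      by exists V => //; rewrite inE Vs orbT.
    - move=> V W x; rewrite !inE => /orP[]HV /orP[]HW xV xW.
      + exact: sun xV xW.
      + by case: (lohi V W x).
      + by case: (lohi W V x).
      + exact: tun xV xW.
  have cross V W a b c : V \in sg -> W \in ta -> a \in V -> b \in W -> c \in V ->
      (b < c)%N -> False.
    move=> Vs Wt aV bW cV bc.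
    have /andP[_] := sub_lo _ _ _ sL Vs cV; have /andP[_ vb] := sub_hi _ _ _ tH Wt bW.
    by rewrite leqNgt (ltn_trans vb bc).
  apply/noncrossingP => V W a b c d; rewrite !inE => /orP[]HV /orP[]HW aV bW cV dW ab bc cd.
  + exact: (snc V W a b c d).
  + by case: (cross V W a b c).
  + by case: (cross W V b c d).
  + exact: (tnc V W a b c d).
rewrite big_imset /=; last first.
  have side1 sg ta : (sg \in nc_partitions_of lo) -> (ta \in nc_partitions_of hi) ->
      [set V in (sg :|: ta)%SET | [forall x in V, (x <= v)%N]]%SET = sg
      /\ [set V in (sg :|: ta)%SET | [forall x in V, (v < x)%N]]%SET = ta.
    move=> sL tH.
    have [/set_partitionP[sne _ _ _] _] := nc_partitions_ofP _ _ sL.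
    have [/set_partitionP[tne _ _ _] _] := nc_partitions_ofP _ _ tH.
    split; apply/finset.setP => V; rewrite !inE; apply/andP/idP.
    - move=> [/orP[//|Vt] /forall_inP Vv].
      have /finset.set0Pn[x xV] := tne V Vt.
      by have /andP[_] := sub_hi _ _ _ tH Vt xV; rewrite ltnNge Vv.
    - move=> Vs; rewrite Vs; split=> //; apply/forall_inP => x xV.
      by have /andP[] := sub_lo _ _ _ sL Vs xV.
    - move=> [/orP[Vs|//] /forall_inP Vv].
      have /finset.set0Pn[x xV] := sne V Vs.
      by have /andP[_] := sub_lo _ _ _ sL Vs xV; rewrite leqNgt Vv.
    - move=> Vs; rewrite Vs orbT; split=> //; apply/forall_inP => x xV.
      by have /andP[] := sub_hi _ _ _ tH Vs xV.
  move=> [s1 t1] [s2 t2] /setIdP[/= /andP[s1L _] t1H] /setIdP[/= /andP[s2L _] t2H] E.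
  have [e1 f1] := side1 _ _ s1L t1H; have [e2 f2] := side1 _ _ s2L t2H.
  by congr pair; [rewrite -e1 -e2 E|rewrite -f1 -f2 E].
rewrite /ncsum big_distrl /=.
under [RHS]eq_bigr do rewrite big_distrr /=.
rewrite pair_big /=; apply: eq_big => [[sg ta]|[sg ta]]; rewrite inE //=.
move=> /andP[/andP[sL _] tH].
rewrite (eq_bigl [predU sg & ta]) => [|V]; last by rewrite !inE.
rewrite bigU //=.
rewrite disjoint_subset; apply/fintype.subsetP => V Vs; rewrite inE; apply/negP => Vt.
exact: disj sL tH V Vs Vt.
Qed.
End Split.

(** Sort the partitions by the last element v of the block of the least element
    i: what follows v splits off, and i is deleted from the rest, where the
    weight of the block of v remembers it. *)
Lemma ncsum_rec K S (i : 'I_n) : i \in S -> (forall x, x \in S -> (i <= x)%N) ->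
  ncsum K S = K [set i]%SET * ncsum K (S :\ i) +
    \sum_(v in (S :\ i)%SET)
      ncsum (fun V => K (if v \in V then i |: V else V)%SET)
            [set x in (S :\ i)%SET | (x <= v)%N]%SET
      * ncsum K [set x in (S :\ i)%SET | (v < x)%N]%SET.
Proof.
move=> iS imin.
pose lastb (pi : {set {set 'I_n}}) :=
  [arg max_(v > i | [exists V in pi, (i \in V) && (v \in V)]) (v : nat)].
have lastP pi v : pi \in nc_partitions_of S -> (lastb pi == v) = last_in_block i v pi.
  move=> /nc_partitions_ofP[/set_partitionP[ne sub ex un] _].
  have [B Bpi iB] := ex i iS.
  rewrite /lastb /last_in_block; case: arg_maxnP => [|w /exists_inP[V Vpi /andP[iV wV]] wmax].
    by apply/exists_inP; exists B; rewrite ?iB.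
  apply/idP/idP => [/eqP <-|/exists_inP[W Wpi /and3P[iW vW /forall_inP Wmax]]].
    apply/exists_inP; exists V => //; rewrite iV wV; apply/forall_inP => y yV; apply: wmax.
    by apply/exists_inP; exists V; rewrite ?iV.
  have vw : (v <= w)%N by apply: wmax; apply/exists_inP; exists W; rewrite ?iW.
  have wv : (w <= v)%N by apply: Wmax; rewrite (un W V i).
  by apply/eqP/val_inj/eqP; rewrite /= eqn_leq wv.
have sum_by_last : ncsum K S =
    \sum_(v in S) \sum_(pi in nc_partitions_of S | last_in_block i v pi) \prod_(V in pi) K V.
  rewrite /ncsum (partition_big lastb (mem S)) /=.
    by apply: eq_bigr => v vS; apply: eq_bigl => pi; apply: andb_id2l => piS; exact: lastP.
  move=> pi piS; have := lastP pi (lastb pi) piS.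
  rewrite eqxx /last_in_block => /esym/exists_inP[V Vpi].
  move=> /and3P[_ lV _].
  by have [/set_partitionP[_ sub _ _] _] := nc_partitions_ofP _ _ piS; apply: sub lV.
have minD v : v != i -> v \in S -> (i < v)%N.
  by move=> vi vS; rewrite ltn_neqAle imin // andbT; apply: contra vi => /eqP/val_inj ->.
rewrite sum_by_last (big_setD1 i) //= ncsum_split //; congr (_ * ncsum K _ + _).
- rewrite -[RHS]ncsum1 /ncsum (_ : [set x in S | (x <= i)%N]%SET = [set i]%SET); last first.
    apply/finset.setP => x; rewrite !inE; apply/andP/eqP => [[xS xi]|->] //.
    by apply/val_inj/eqP; rewrite /= eqn_leq xi imin.
  apply: eq_bigl => pi; apply: andb_idr => /nc_partitions_ofP[/set_partitionP[_ _ ex _] _].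
  have [V Vpi iV] := ex i (finset.set11 i).
  by apply/exists_inP; exists V; rewrite ?iV.
- apply/finset.setP => x; rewrite !inE; apply/andP/andP => [[xS ix]|[xi xS]].
    by split=> //; apply/eqP => xi; rewrite xi ltnn in ix.
  by split=> //; apply: minD.
apply: eq_bigr => v; rewrite !inE => /andP[vi vS].
rewrite ncsum_split // ncsum_same_block //; first last.
- by move=> x; rewrite inE => /andP[].
- by move=> x; rewrite inE => /andP[/imin].
- by rewrite eq_sym.
- by rewrite inE vS leqnn.
- by rewrite inE iS imin.
congr (ncsum _ _ * ncsum _ _).
  by apply/finset.setP => x; rewrite !inE andbA.
apply/finset.setP => x; rewrite !inE; have [->|//] := eqVneq x i.
by rewrite ltnNge imin // andbF.
Qed.

End NoncrossingSums.

(** * The recursion for the moments of a compound free Poisson law *)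

Section PoissonRecursion.
Variables (F : comNzRingType) (I : Type) (t : seq I -> F).

(** Letters are themselves words over I, multiplied by concatenation, and t is
    the common value of the cumulants on the product of their arguments.  The
    first letter x either is a block by itself or is absorbed by the letter in
    position p that ends its block.  The recursion is not structural; n bounds
    its depth. *)
Fixpoint poisson_rec (n : nat) (W : seq (seq I)) : F :=
  match n, W with
  | _, [::] => 1
  | 0, _ :: _ => 0
  | n'.+1, x :: W' => t x * poisson_rec n' W' +
      \sum_(p < size W')
        poisson_rec n' (rcons (take p W') (nth [::] W' p ++ x))
        * poisson_rec n' (drop p.+1 W')
  end.

Lemma poisson_rec_fuel n m W : (size W <= n)%N -> (size W <= m)%N ->
  poisson_rec n W = poisson_rec m W.
Proof.
elim: n m W => [|n IH] [|m] [|x W] //=; rewrite !ltnS => Wn Wm.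
congr (_ * _ + _); first exact: IH.
have small (p : 'I_(size W)) k : (size W <= k)%N ->
    (size (rcons (take p W) (nth [::] W p ++ x)) <= k)%N
    && (size (drop p.+1 W) <= k)%N.
  move=> Wk; rewrite size_rcons size_take ltn_ord size_drop.
  by rewrite (leq_trans (ltn_ord p)) // (leq_trans (leq_subr _ _)).
apply: eq_bigr => p _.
have /andP[? ?] := small p n Wn; have /andP[? ?] := small p m Wm.
by congr (_ * _); apply: IH.
Qed.

Definition poisson_moment W := poisson_rec (size W) W.

Lemma poisson_moment_nil : poisson_moment [::] = 1. Proof. by []. Qed.

Lemma poisson_moment_cons x W :
  poisson_moment (x :: W) = t x * poisson_moment W +
    \sum_(p < size W) poisson_moment (rcons (take p W) (nth [::] W p ++ x))
      * poisson_moment (drop p.+1 W).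
Proof.
rewrite {1}/poisson_moment /=; congr (_ + _); apply: eq_bigr => p _.
congr (_ * _); apply: poisson_rec_fuel => //.
  by rewrite size_rcons size_take ltn_ord.
by rewrite size_drop leq_subr.
Qed.
End PoissonRecursion.

(** As a strictly sorted sequence, the enumeration of a set of ordinals is
    determined by its elements. *)
Definition ord_lt (n : nat) : rel 'I_n := fun i j => (i < j)%N.

Lemma ord_lt_trans (n : nat) : transitive (@ord_lt n).
Proof. by move=> j i k; apply: ltn_trans. Qed.

Lemma enum_set_pairwise (n : nat) (S : {set 'I_n}) : pairwise (@ord_lt n) (enum S).
Proof.
rewrite -(sorted_pairwise (@ord_lt_trans n)).
apply: (subseq_sorted (@ord_lt_trans n) (filter_subseq _ _)).
rewrite -enumT; have := iota_ltn_sorted 0 n.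
by rewrite -val_enum_ord sorted_map.
Qed.

Lemma eq_enum_pairwise (n : nat) (S : {set 'I_n}) (s : seq 'I_n) :
  pairwise (@ord_lt n) s -> (forall x, (x \in s) = (x \in S)) -> enum S = s.
Proof.
move=> ss sE; apply: (irr_sorted_eq (@ord_lt_trans n)) => [x|||x].
- by rewrite /ord_lt ltnn.
- exact/pairwise_sorted/enum_set_pairwise.
- exact/pairwise_sorted.
- by rewrite mem_enum sE.
Qed.

Lemma enum_setU1_min (n : nat) (i : 'I_n) (S : {set 'I_n}) :
  (forall x, x \in S -> (i < x)%N) -> enum (i |: S)%SET = i :: enum S.
Proof.
move=> imin; apply: eq_enum_pairwise => [/=|x]; last by rewrite !inE mem_enum.
rewrite enum_set_pairwise andbT; apply/allP => x; rewrite mem_enum; exact: imin.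
Qed.

Section SumOverNoncrossing.
Variables (F : comNzRingType) (I : Type) (t : seq I -> F).
Hypothesis tC : forall u v, t (u ++ v) = t (v ++ u).
Variable n : nat.
Implicit Types (S V : {set 'I_n}) (w : 'I_n -> seq I).

Definition block_value w V := t (flatten [seq w j | j <- enum V]).

(** The non-crossing sum obeys the recursion by ncsum_rec: cyclic invariance of t
    moves the letter of i from the front of the block of v to its end, where it
    is absorbed by the letter of v. *)
Lemma ncsum_poisson_rec m w S : (#|S| <= m)%N ->
  ncsum (block_value w) S = poisson_rec t m [seq w j | j <- enum S].
Proof.
elim: m w S => [|m IH] w S.
  by rewrite leqn0 cards_eq0 => /eqP ->; rewrite ncsum0 enum_set0.
have [->|] := eqVneq S finset.set0; first by rewrite ncsum0 enum_set0.
move=> /finset.set0Pn[i0 i0S].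
case: (arg_minnP (fun x : 'I_n => x : nat) i0S) => i iS' imin Sm.
have iS : i \in S := iS'.
set S' := (S :\ i)%SET; pose e := enum S'.
have lti x : x \in S' -> (i < x)%N.
  rewrite !inE => /andP[xi xS]; rewrite ltn_neqAle imin // andbT.
  by apply: contra xi => /eqP/val_inj ->.
have eS : enum S = i :: e by rewrite -(finset.setD1K iS) enum_setU1_min.
have S'm : (#|S'| <= m)%N by move: Sm; rewrite (cardsD1 i) iS.
have sub_card (A : {set 'I_n}) : A \subset S' -> (#|A| <= m)%N.
  by move=> /subset_leq_card /leq_trans; apply.
rewrite eS (ncsum_rec _ iS) => [/=|x xS]; last exact: imin.
congr (_ + _).
  by rewrite {1}/block_value enum_set1 /= cats0 IH.
have sz : size [seq w j | j <- e] = size e by rewrite size_map.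
transitivity (\sum_(v <- e)
   ncsum (fun V => block_value w (if v \in V then i |: V else V)%SET)
            [set x in S' | (x <= v)%N]%SET
      * ncsum (block_value w) [set x in S' | (v < x)%N]%SET).
  by rewrite big_enum.
rewrite (big_nth i) big_mkord sz; apply: eq_bigr => -[p pe] _ /=.
have se : pairwise (@ord_lt n) e := enum_set_pairwise S'.
set v := nth i e p.
have vS' : v \in S' by rewrite -mem_enum mem_nth.
have eE : e = rcons (take p e) v ++ drop p.+1 e.
  by rewrite -take_nth // cat_take_drop.
have := se; rewrite {1}eE pairwise_cat pairwise_rcons.
move=> /and3P[/allrelP vd /andP[/allP vt pt] pd].
have lo_lt x : x \in take p e -> (x < v)%N by move=> /vt.
have hi_lt x : x \in drop p.+1 e -> (v < x)%N.
  by apply: vd; rewrite mem_rcons mem_head.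
have lo_enum : enum [set x in S' | (x <= v)%N]%SET = rcons (take p e) v.
  apply: eq_enum_pairwise => [|x]; first by rewrite pairwise_rcons pt andbT; apply/allP.
  rewrite inE -(mem_enum S') -/e [in RHS]eE mem_cat.
  case: (boolP (x \in rcons _ _)) => [|_] /=.
    by rewrite mem_rcons inE => /orP[/eqP ->|/lo_lt/ltnW ->] //; rewrite leqnn.
  by case: (boolP (x \in drop _ _)) => //= /hi_lt; rewrite ltnNge => /negbTE.
have hi_enum : enum [set x in S' | (v < x)%N]%SET = drop p.+1 e.
  apply: eq_enum_pairwise => // x.
  rewrite inE -(mem_enum S') -/e [in RHS]eE mem_cat.
  case: (boolP (x \in drop _ _)) => [/hi_lt ->|_] /=; first by rewrite orbT.
  rewrite orbF mem_rcons inE; apply/esym/negP => /andP[/orP[/eqP ->|/lo_lt xv]].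
    by rewrite ltnn.
  by rewrite ltnNge ltnW.
congr (_ * _); last first.
  rewrite IH; last by apply: sub_card; apply/fintype.subsetP => x; rewrite inE => /andP[].
  by rewrite -/v hi_enum map_drop.
(* the letter of i is absorbed by the letter of v, on its right *)
pose w' j := if j == v then w v ++ w i else w j.
transitivity (ncsum (block_value w') [set x in S' | (x <= v)%N]%SET).
  apply: eq_ncsum => V Vlo; rewrite /block_value.
  have Vle x : x \in V -> (x <= v)%N by move=> /(fintype.subsetP Vlo); rewrite inE => /andP[].
  have VS' x : x \in V -> x \in S' by move=> /(fintype.subsetP Vlo); rewrite inE => /andP[].
  have w'E (s : seq 'I_n) : v \notin s -> [seq w' j | j <- s] = [seq w j | j <- s].
    by move=> vs; apply/eq_in_map => j js; rewrite /w' (negbTE (memPn vs j js)).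
  case: ifP => [vV|/negbT vV]; last by rewrite w'E // mem_enum.
  rewrite enum_setU1_min => [/=|x xV]; last exact/lti/VS'.
  have -> : enum V = rcons (enum (V :\ v)%SET) v.
    apply: eq_enum_pairwise => [|x]; last first.
      by rewrite mem_rcons inE mem_enum !inE; case: eqVneq => [->|//]; rewrite vV.
    rewrite pairwise_rcons enum_set_pairwise andbT; apply/allP => x.
    rewrite mem_enum !inE /ord_lt => /andP[xv xV].
    by rewrite ltn_neqAle Vle // andbT; apply: contra xv => /eqP/val_inj ->.
  rewrite !map_rcons !flatten_rcons w'E; last by rewrite mem_enum !inE eqxx.
  by rewrite tC /w' eqxx !catA.
rewrite IH; last by apply: sub_card; apply/fintype.subsetP => x; rewrite inE => /andP[].
rewrite lo_enum map_rcons -map_take; congr (poisson_rec _ _ (rcons _ _)).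
  apply/eq_in_map => j /lo_lt; rewrite /w'; case: eqVneq => // ->.
  by rewrite ltnn.
by rewrite /w' eqxx (nth_map i).
Qed.

Lemma ncsum_poisson_moment w S :
  ncsum (block_value w) S = poisson_moment t [seq w j | j <- enum S].
Proof. by rewrite /poisson_moment size_map -cardE; apply: ncsum_poisson_rec. Qed.
End SumOverNoncrossing.

(** * The moment-cumulant formula *)

Section MomentCumulant.
Variables (F : comNzRingType) (T : Type) (x0 : T).
Implicit Types (k M : seq T -> F) (s : seq T).

Definition block_word s (V : {set 'I_(size s)}) :=
  [seq nth x0 s j | j : 'I_(size s) <- enum V].

Definition nc_moment k s : F :=
  \sum_(pi in noncrossing_partitions (size s))
    \prod_(V in pi) k (block_word V).

(** The contribution of the partitions with at least two blocks; it involves only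
    cumulants of shorter words, which makes the moment-cumulant formula
    triangular. *)
Definition proper_nc_moment k s : F :=
  \sum_(pi in noncrossing_partitions (size s) | pi != [set [set: 'I_(size s)]]%SET)
    \prod_(V in pi) k (block_word V).

Lemma nc_momentE k s : (0 < size s)%N -> nc_moment k s = k s + proper_nc_moment k s.
Proof.
move=> s0; rewrite /nc_moment (bigD1 [set [set: 'I_(size s)]]%SET) /=.
  congr (_ + _); rewrite big_set1 /block_word enum_setT -enumT; congr k.
  by rewrite (map_comp (nth x0 s) val) val_enum_ord map_nth_iota0 ?take_size.
apply/nc_partitions_ofP; split; last first.
  by apply/noncrossingP => V W a b c d; rewrite !inE => /eqP -> /eqP ->.
apply/set_partitionP; split => [V|V x|x _|V W x].
- rewrite inE => /eqP ->; apply/finset.set0Pn.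
  by exists (Ordinal s0); rewrite inE.
- by rewrite !inE.
- by exists [set: _]%SET; rewrite inE.
- by rewrite !inE => /eqP -> /eqP ->.
Qed.

Lemma block_word_size s (pi : {set {set 'I_(size s)}}) V :
  pi \in noncrossing_partitions (size s) -> pi != [set [set: 'I_(size s)]]%SET ->
  V \in pi -> (0 < size (block_word V) < size s)%N.
Proof.
move=> /nc_partitions_ofP[/set_partitionP[ne _ _ un] _] piT Vpi.
rewrite size_map -cardE card_gt0 (ne V Vpi) /= -[X in (_ < X)%N]card_ord.
rewrite ltn_neqAle max_card andbT.
apply: contra piT => cV.
have VT : V = [set: _]%SET.
  by apply/eqP; rewrite finset.eqEcard finset.subsetT /= finset.cardsT (eqP cV).
apply/eqP/finset.setP => W; rewrite inE -VT; apply/idP/eqP => [Wpi|-> //].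
have /finset.set0Pn[x xW] := ne W Wpi.
by apply: (un W V x) => //; rewrite VT inE.
Qed.

Lemma eq_proper_nc_moment k k' s :
  (forall u, (0 < size u < size s)%N -> k u = k' u) ->
  proper_nc_moment k s = proper_nc_moment k' s.
Proof.
move=> kk'; apply: eq_bigr => pi /andP[piNC piT]; apply: eq_bigr => V Vpi.
by apply: kk'; apply: block_word_size Vpi.
Qed.

Lemma cumulant_exists M : exists k, forall s, (0 < size s)%N -> M s = nc_moment k s.
Proof.
(* recursion on the length of s, bounded by n *)
pose fix kap (n : nat) s {struct n} : F :=
  if n is n'.+1 then M s - proper_nc_moment (kap n') s else 0.
have kapS n s : (0 < size s <= n)%N -> kap n s = kap (size s) s.
  elim/ltn_ind: n s => -[|n] IH s /andP[s0]; first by rewrite leqNgt s0.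
  move=> sn; case Es: (size s) s0 => [//|m] _ /=; congr (_ - _).
  apply: eq_proper_nc_moment => u /andP[u0 us].
  rewrite Es in sn us; rewrite IH // ?u0 /= -1?ltnS ?(leq_trans us) //.
  by rewrite [RHS]IH // u0.
exists (fun s => kap (size s) s) => s s0.
rewrite nc_momentE //; case Es: (size s) (s0) => [//|m] _ /=.
rewrite -[LHS]addr0 -addrA; congr (_ + _); apply/esym/eqP.
rewrite addrC subr_eq0; apply/eqP; apply: eq_proper_nc_moment => u /andP[u0 us].
by rewrite [RHS]kapS // u0 -ltnS -Es.
Qed.

Lemma cumulant_unique k k' :
  (forall s, (0 < size s)%N -> nc_moment k s = nc_moment k' s) ->
  forall s, (0 < size s)%N -> k s = k' s.
Proof.
move=> kk' s; have [n] := ubnP (size s); elim: n s => // n IH s sn s0.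
have := kk' s s0; rewrite !nc_momentE //.
rewrite (@eq_proper_nc_moment k k') => [/addIr //|u /andP[u0 us]].
by apply: IH => //; rewrite (leq_trans us).
Qed.

End MomentCumulant.

Lemma nc_moment_map (F : comNzRingType) (T U : Type) (x0 : T) (y0 : U) (f : T -> U)
    (k : seq U -> F) s :
  nc_moment y0 k (map f s) = nc_moment x0 (fun u => k (map f u)) s.
Proof.
have szE := size_map f s; rewrite /nc_moment.
suff H m (e : m = size s) :
   \sum_(pi in noncrossing_partitions m)
     \prod_(V in pi) k [seq nth y0 (map f s) j | j : 'I_m <- enum V] =
   \sum_(pi in noncrossing_partitions (size s))
     \prod_(V in pi) k (map f (block_word x0 V)).
  exact: H.
subst m; apply: eq_bigr => pi _; apply: eq_bigr => V _; congr k.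
by rewrite -map_comp; apply: eq_map => j /=; rewrite (nth_map x0).
Qed.

Lemma nc_moment_poisson (F : comNzRingType) (I : Type) (x0 : I) (t : seq I -> F) s :
  (forall u v, t (u ++ v) = t (v ++ u)) ->
  nc_moment x0 t s = poisson_moment t [seq [:: x] | x <- s].
Proof.
move=> tC.
have -> : [seq [:: x] | x <- s] =
    [seq [:: nth x0 s j] | j : 'I_(size s) <- enum [set: 'I_(size s)]%SET].
  rewrite enum_setT -enumT (map_comp (fun x => [:: x]) (fun j : 'I_(size s) => nth x0 s j)).
  by rewrite (map_comp (nth x0 s) val) val_enum_ord map_nth_iota0 ?take_size.
rewrite -(ncsum_poisson_moment tC); apply: eq_bigr => pi _; apply: eq_bigr => V _.
congr t; rewrite /block_word; by elim: (enum V) => //= j e ->.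
Qed.

(** * Loop equations of the Wishart model *)

(** The word obtained from the cyclic words x :: W and V when the first factor of
    x :: W is contracted with the last factor of the u-th letter of V: V is
    opened after that letter, which absorbs x. *)
Definition merge_words (I : Type) (x : seq I) (W V : seq (seq I)) (u : nat) :=
  W ++ drop u.+1 V ++ rcons (take u V) (nth [::] V u ++ x).

(** Correlators G of lists of cyclic words: the first factor of the first letter
    x is contracted within x, with a later letter of the same word, or with a
    letter of another word, the last at the price of a factor e. *)
Definition loop_equations (F : pzRingType) (I : Type) (t : seq I -> F) (e : F)
    (G : seq (seq (seq I)) -> F) : Prop :=
  [/\ G [::] = 1,
      forall ws, G ([::] :: ws) = G ws &
      forall x W ws, G ((x :: W) :: ws) =
        t x * G (W :: ws) +
        \sum_(p < size W)
          G [:: rcons (take p W) (nth [::] W p ++ x), drop p.+1 W & ws] +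
        e * \sum_(j < size ws) \sum_(u < size (nth [::] ws j))
          G (merge_words x W (nth [::] ws j) u :: take j ws ++ drop j.+1 ws)].

(** The Gaussian calculus enters only through derivations d i l dual to the
    entries of C and an expectation E that satisfies integration by parts: C' l i
    stands for the conjugate of C i l. *)
Section LoopEquation.
Variables (F P : comNzRingType) (alpha : {rmorphism F -> P}) (I : Type) (k r : nat).
Variables (D : seq I -> 'M[F]_k) (c : F).
Hypothesis DM : forall u v, D (u ++ v) = D u *m D v.
Hypothesis cr : c * r%:R = 1.

Variables (E : {additive P -> F}) (d : 'I_k -> 'I_r -> {additive P -> P}).
Variables (C : 'M[P]_(k, r)) (C' : 'M[P]_(r, k)).
Hypothesis E1 : E 1 = 1.
Hypothesis EM : forall a p, E (alpha a * p) = a * E p.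
Hypothesis dM : forall i l p q, d i l (p * q) = d i l p * q + p * d i l q.
Hypothesis dA : forall i l (a : F), d i l (alpha a) = 0.
Hypothesis dC : forall i l i' l', d i l (C i' l') = ((i == i') && (l == l'))%:R.
Hypothesis dC' : forall i l i' l', d i l (C' l' i') = 0.
Hypothesis ibp : forall i l p, E (C' l i * p) = E (d i l p).

Definition const_letter x : 'M[P]_k := map_mx alpha (D x).
Definition wishart x : 'M[P]_r := alpha c *: (C' *m const_letter x *m C).
Fixpoint wishart_word (W : seq (seq I)) : 'M[P]_r :=
  if W is x :: W' then wishart x *m wishart_word W' else 1%:M.
Definition word_trace W : P := alpha c * \tr (wishart_word W).
Definition multitrace (ws : seq (seq (seq I))) : F := E (\prod_(W <- ws) word_trace W).

Lemma wishart_word_cat W V :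
  wishart_word (W ++ V) = wishart_word W *m wishart_word V.
Proof. by elim: W => [|x W IH] /=; rewrite ?mul1mx // IH mulmxA. Qed.

Lemma wishart_word_rcons W x :
  wishart_word (rcons W x) = wishart_word W *m wishart x.
Proof. by rewrite -cats1 wishart_word_cat /= mulmx1. Qed.

Lemma const_letterM u v : const_letter (u ++ v) = const_letter u *m const_letter v.
Proof. by rewrite /const_letter DM map_mxM. Qed.

Let dmxM i l (a b e : nat) (A : 'M[P]_(a, b)) (B : 'M[P]_(b, e)) :
  map_mx (d i l) (A *m B) = map_mx (d i l) A *m B + A *m map_mx (d i l) B.
Proof.
apply/matrixP => x y; rewrite !mxE raddf_sum -big_split /=.
by apply: eq_bigr => z _; rewrite !mxE dM.
Qed.

Let d0 i l : d i l 1 = 0. Proof. by rewrite -(rmorph1 alpha) dA. Qed.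

Let dmx_letter i l x : map_mx (d i l) (const_letter x) = 0.
Proof. by apply/matrixP => a b; rewrite !mxE dA. Qed.

Let dmxC i l : map_mx (d i l) C = delta_mx i l.
Proof. by apply/matrixP => a b; rewrite !mxE dC [a == i]eq_sym [b == l]eq_sym. Qed.

Let dmxC' i l : map_mx (d i l) C' = 0.
Proof. by apply/matrixP => a b; rewrite !mxE dC'. Qed.

Let dcA i l p : d i l (alpha c * p) = alpha c * d i l p.
Proof. by rewrite dM dA mul0r add0r. Qed.

Let dmxZ i l (a b : nat) (A : 'M[P]_(a, b)) :
  map_mx (d i l) (alpha c *: A) = alpha c *: map_mx (d i l) A.
Proof. by apply/matrixP => x y; rewrite !mxE dcA. Qed.

Let half x : 'M[P]_(r, k) := alpha c *: (C' *m const_letter x).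

Let wishartE x : wishart x = half x *m C.
Proof. by rewrite /wishart /half scalemxAl. Qed.

Let halfM x y : half x *m const_letter y = half (x ++ y).
Proof. by rewrite /half -scalemxAl const_letterM mulmxA. Qed.

Lemma deriv_wishart i l x : map_mx (d i l) (wishart x) = half x *m delta_mx i l.
Proof.
rewrite wishartE dmxM dmxC /half dmxZ dmxM dmxC' dmx_letter.
by rewrite mul0mx mulmx0 add0r scaler0 mul0mx add0r.
Qed.

Lemma deriv_wishart_word i l W : map_mx (d i l) (wishart_word W) =
  \sum_(u < size W) wishart_word (take u W) *m half (nth [::] W u) *m
     delta_mx i l *m wishart_word (drop u.+1 W).
Proof.
elim: W => [|x W IH] /=.
  rewrite big_ord0; apply/matrixP => a b; rewrite !mxE.
  by case: (a == b) => /=; rewrite ?d0 ?raddf0.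
rewrite big_ord_recl /= drop0 mul1mx dmxM deriv_wishart IH.
congr (_ + _); rewrite mulmx_sumr; apply: eq_bigr => u _.
by rewrite /= !mulmxA.
Qed.

Let mul_delta_mxE (a b : nat) (A : 'M[P]_(a, k)) (B : 'M[P]_(r, b)) i l x y :
  (A *m delta_mx i l *m B) x y = A x i * B l y.
Proof.
by rewrite -(mul_delta_mx (0 : 'I_1)) mulmxA -colE -mulmxA -rowE mxE big_ord1 !mxE.
Qed.

Let sum_delta_mx (A : 'M[P]_k) (B : 'M[P]_r) :
  \sum_l \sum_i (A *m delta_mx i l *m B) i l = \tr A * \tr B.
Proof.
rewrite mulrC mulr_suml; apply: eq_bigr => l _; rewrite mulr_sumr.
by apply: eq_bigr => i _; rewrite mul_delta_mxE mulrC.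
Qed.

Let sum_delta_trace (M : 'M[P]_(k, r)) (A : 'M[P]_(r, k)) (B : 'M[P]_r) :
  \sum_l \sum_i M i l * \tr (A *m delta_mx i l *m B) = \tr (M *m B *m A).
Proof.
rewrite -mulmxA exchange_big /= [RHS]/mxtrace; apply: eq_bigr => i _.
rewrite [RHS]mxE; apply: eq_bigr => l _; congr (_ * _).
by rewrite mxE /mxtrace; apply: eq_bigr => x _; rewrite mul_delta_mxE mulrC.
Qed.

(** The word x :: W after removal of its leading factor C'. *)
Let tail x W : 'M[P]_(k, r) := const_letter x *m C *m wishart_word W.

(** Contraction within the word: differentiating the C of a letter cuts the trace
    there, and the first part is closed up by the cyclicity of the trace. *)
Let deriv_tail x W :
  \sum_l \sum_i d i l (tail x W i l) =
  \tr (const_letter x) * \tr (wishart_word W) +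
  \sum_(p < size W) \tr (wishart_word (rcons (take p W) (nth [::] W p ++ x)))
     * \tr (wishart_word (drop p.+1 W)).
Proof.
have E0 l i : d i l (tail x W i l) =
    (const_letter x *m delta_mx i l *m wishart_word W) i l +
    \sum_(p < size W) (const_letter x *m C *m wishart_word (take p W) *m
       half (nth [::] W p) *m delta_mx i l *m wishart_word (drop p.+1 W)) i l.
  have -> : d i l (tail x W i l) = map_mx (d i l) (tail x W) i l by rewrite [RHS]mxE.
  rewrite /tail dmxM dmxM dmx_letter dmxC mul0mx add0r mxE; congr (_ + _).
  rewrite deriv_wishart_word mulmx_sumr summxE.
  by apply: eq_bigr => p _; rewrite !mulmxA.
under eq_bigr do under eq_bigr do rewrite E0.
under eq_bigr do rewrite big_split /=.
rewrite big_split /= sum_delta_mx; congr (_ + _).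
under eq_bigr do rewrite exchange_big /=.
rewrite exchange_big /=; apply: eq_bigr => p _.
rewrite sum_delta_mx; congr (_ * _).
rewrite wishart_word_rcons wishartE -halfM.
rewrite -!mulmxA mxtrace_mulC -!mulmxA mxtrace_mulC -!mulmxA.
by rewrite mxtrace_mulC -!mulmxA.
Qed.

(** Contraction with another word V, which is spliced into x :: W. *)
Let deriv_word_trace x W V :
  \sum_l \sum_i tail x W i l * d i l (word_trace V) =
  alpha c * \sum_(u < size V) \tr (wishart_word
    (W ++ drop u.+1 V ++ rcons (take u V) (nth [::] V u ++ x))).
Proof.
have E0 l i : d i l (word_trace V) = alpha c *
    \sum_(u < size V) \tr (wishart_word (take u V) *m half (nth [::] V u) *m
       delta_mx i l *m wishart_word (drop u.+1 V)).
  rewrite /word_trace dcA; congr (_ * _).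
  rewrite -[RHS]raddf_sum -deriv_wishart_word raddf_sum.
  by apply: eq_bigr => a _; rewrite mxE.
under eq_bigr do under eq_bigr do rewrite E0 mulrCA.
under eq_bigr do rewrite -mulr_sumr.
rewrite -mulr_sumr; congr (_ * _).
under eq_bigr do under eq_bigr do rewrite mulr_sumr.
under eq_bigr do rewrite exchange_big /=.
rewrite exchange_big /=; apply: eq_bigr => u _.
rewrite sum_delta_trace /tail !wishart_word_cat wishart_word_rcons wishartE -halfM.
by rewrite -!mulmxA mxtrace_mulC -!mulmxA mxtrace_mulC -!mulmxA.
Qed.

Let deriv_words i l ws : d i l (\prod_(V <- ws) word_trace V) =
  \sum_(j < size ws) d i l (word_trace (nth [::] ws j)) *
     \prod_(V <- take j ws ++ drop j.+1 ws) word_trace V.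
Proof.
elim: ws => [|V ws IH] /=; first by rewrite big_nil big_ord0 d0.
rewrite big_cons dM IH big_ord_recl /= drop0; congr (_ + _).
rewrite mulr_sumr; apply: eq_bigr => j _ /=; rewrite big_cons; exact: mulrCA.
Qed.

(** Integration by parts with respect to the leading C' of the first word.  The
    normalizations leave c^0 when a trace is cut in two and c^2 when two traces
    are merged into one. *)
Lemma loop_equation x W ws :
  multitrace ((x :: W) :: ws) =
    c * \tr (D x) * multitrace (W :: ws) +
    \sum_(p < size W)
      multitrace [:: rcons (take p W) (nth [::] W p ++ x), drop p.+1 W & ws] +
    c ^+ 2 * \sum_(j < size ws) \sum_(u < size (nth [::] ws j))
      multitrace (merge_words x W (nth [::] ws j) u :: take j ws ++ drop j.+1 ws).
Proof.
set f := \prod_(V <- ws) word_trace V.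
have -> : multitrace ((x :: W) :: ws) =
    c * (c * \sum_l \sum_i E (C' l i * (tail x W i l * f))).
  rewrite /multitrace big_cons -/f /word_trace /= /wishart -!scalemxAl mxtraceZ.
  rewrite -!mulrA EM EM; congr (_ * (_ * _)).
  rewrite /mxtrace mulr_suml raddf_sum; apply: eq_bigr => l _ /=.
  rewrite -!mulmxA mxE mulr_suml raddf_sum; apply: eq_bigr => i _ /=.
  by rewrite /tail -!mulmxA mulrA.
transitivity (c * (c * (E ((\sum_l \sum_i d i l (tail x W i l)) * f) +
   E (\sum_(j < size ws) (\sum_l \sum_i tail x W i l * d i l (word_trace (nth [::] ws j))) *
     \prod_(V <- take j ws ++ drop j.+1 ws) word_trace V)))).
  congr (_ * (_ * _)).
  under eq_bigr do under eq_bigr do rewrite ibp dM raddfD.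
  under eq_bigr do rewrite big_split /=.
  rewrite big_split /=; congr (_ + _).
    rewrite mulr_suml raddf_sum; apply: eq_bigr => l _ /=.
    by rewrite mulr_suml raddf_sum.
  under eq_bigr do rewrite -raddf_sum.
  rewrite -raddf_sum; congr (E _).
  transitivity (\sum_l \sum_i \sum_(j < size ws) tail x W i l *
      (d i l (word_trace (nth [::] ws j)) *
       \prod_(V <- take j ws ++ drop j.+1 ws) word_trace V)).
    apply: eq_bigr => l _; apply: eq_bigr => i _.
    by rewrite /f deriv_words mulr_sumr.
  under [LHS]eq_bigr do rewrite exchange_big /=.
  rewrite exchange_big /=; apply: eq_bigr => j _.
  rewrite mulr_suml; apply: eq_bigr => l _; rewrite mulr_suml; apply: eq_bigr => i _.
  exact: mulrA.
have trD : \tr (const_letter x) = alpha (\tr (D x)).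
  by rewrite /const_letter /mxtrace rmorph_sum; apply: eq_bigr => i _; rewrite mxE.
rewrite deriv_tail mulrDl raddfD /= trD !mulrDr -!addrA; congr (_ + (_ + _)).
- rewrite /multitrace big_cons -/f /word_trace -!mulrA !EM; congr (_ * _); exact: mulrCA.
- rewrite mulr_suml raddf_sum !mulr_sumr; apply: eq_bigr => p _ /=.
  by rewrite /multitrace !big_cons -/f /word_trace -!mulrA EM [X in E X]mulrCA EM.
rewrite raddf_sum !mulr_sumr; apply: eq_bigr => j _ /=.
rewrite deriv_word_trace -mulrA EM mulr_suml raddf_sum !mulr_sumr.
apply: eq_bigr => u _ /=.
rewrite /multitrace big_cons -/(merge_words x W (nth [::] ws j) u) /word_trace.
by rewrite -mulrA EM expr2 !mulrA.
Qed.

Lemma multitrace_nil : multitrace [::] = 1.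
Proof. by rewrite /multitrace big_nil. Qed.

Lemma multitrace_cons_nil ws : multitrace ([::] :: ws) = multitrace ws.
Proof.
rewrite /multitrace big_cons /word_trace /= mxtrace1 -(rmorph_nat alpha).
by rewrite -rmorphM /= cr rmorph1 mul1r.
Qed.

Lemma multitrace_loop_equations :
  loop_equations (fun x => c * \tr (D x)) (c ^+ 2) multitrace.
Proof.
split; [exact: multitrace_nil|exact: multitrace_cons_nil|exact: loop_equation].
Qed.
End LoopEquation.

(** * Existence of an algebra with prescribed moments *)

Section FreeAlgebra.
Import -(notations) monalg.
Variables (F : comNzRingType) (I : choiceType).

Lemma malg_scalerAr (K : monomType) (c : F) (g h : malg K F) :
  c *: (g * h) = g * (c *: h).
Proof.
apply/malgP => k; rewrite mcoeffZ mcoeffMl.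
rewrite (mcoeffMlw _ (finmap.fsubset_refl _) (msuppZ_le c h)).
rewrite mulr_sumr; apply: eq_bigr => k1 _; rewrite mulr_sumr; apply: eq_bigr => k2 _.
by rewrite mcoeffZ mulrnAr mulrCA.
Qed.

(** A fresh name for the monoid algebra: on the original one the algebra structure
    for commutative monoids takes precedence in inference. *)
Definition free_algebra : Type := malg (fmonom I) F.

HB.instance Definition _ := GRing.Lalgebra.on free_algebra.

HB.instance Definition _ :=
  GRing.Lalgebra_isAlgebra.Build F free_algebra (@malg_scalerAr (fmonom I)).

Variable nu : seq I -> F.

Definition word_functional : free_algebra -> F :=
  mmap idfun (fun k : fmonom I => nu k).

Lemma word_functional_linear : scalar word_functional.
Proof.
move=> c g h; rewrite /word_functional raddfD /=; congr (_ + _).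
rewrite (mmapEw (msuppZ_le c g)) mmapE mulr_sumr.
by apply: eq_bigr => k _; rewrite /= mcoeffZ mulrA.
Qed.

HB.instance Definition _ := GRing.isLinear.Build F (free_algebra) F *%R
  word_functional word_functional_linear.

Definition word_letter (i : I) : free_algebra := mkmalgU (fmu i) 1.

Lemma word_functional_prod w : word_functional (\prod_(i <- w) word_letter i) = nu w.
Proof.
have -> : \prod_(i <- w) word_letter i = mkmalgU (FMonom w) 1.
  elim: w => [|i w IH]; first by rewrite big_nil -fmoneE.
  rewrite big_cons IH malgM_def fgmulUU mulr1; congr mkmalgU.
  by rewrite /= /mmul /= fmmulE fmuE.
by rewrite /word_functional mmapU /= mul1r.
Qed.

Lemma word_functional_exists : exists (B : algType F) (psi : {scalar B}) (y : I -> B),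
  forall w, psi (\prod_(i <- w) y i) = nu w.
Proof.
exists (free_algebra : algType F), (word_functional : {scalar free_algebra}).
by exists word_letter; apply: word_functional_prod.
Qed.
End FreeAlgebra.

(** * Gaussian expectation of polynomials *)

(** Variables come in n conjugate pairs, of indices lshift n x and rshift n x;
    the expectation of z'^p z^q is p! if p = q and 0 otherwise, and distinct
    pairs are independent. *)
Section GaussianFunctional.
Import -(notations) mpoly.
Variables (F : comNzRingType) (n : nat).
Local Notation P := (mpoly (n + n) F).
Implicit Types (p : P) (m : multinom (n + n)).

Definition gaussian_weight m : F := \prod_(x < n)
  (if m (lshift n x) == m (rshift n x) then (m (rshift n x))`!%:R else 0).

Definition gaussian p : F := \sum_(m <- msupp p) mcoeff m p * gaussian_weight m.

Lemma gaussianE p k : (msize p <= k)%N ->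
  gaussian p = \sum_(m : bmultinom (n + n) k) mcoeff m p * gaussian_weight m.
Proof.
pose J : subFinType _ := bmultinom (n + n) k.
move=> le_pk; rewrite /gaussian (ssrcomplements.big_mksub J) /=; first last.
- by move=> m /msize_mdeg_lt/leq_trans/(_ le_pk).
- by rewrite msupp_uniq.
by rewrite big_rmcond //= => m /memN_msupp_eq0 ->; rewrite mul0r.
Qed.

Lemma gaussian_additive : zmod_morphism gaussian.
Proof.
move=> p q; pose k := maxn (msize (p - q)) (maxn (msize p) (msize q)).
rewrite !(@gaussianE _ k) ?leq_max ?leqnn ?orbT // -sumrB.
by apply: eq_bigr => m _; rewrite mcoeffB mulrBl.
Qed.

HB.instance Definition _ := GRing.isZmodMorphism.Build P F gaussian gaussian_additive.

Lemma gaussianZ c p : gaussian (c *: p) = c * gaussian p.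
Proof.
pose k := maxn (msize (c *: p)) (msize p).
rewrite !(@gaussianE _ k) ?leq_max ?leqnn ?orbT // mulr_sumr.
by apply: eq_bigr => m _; rewrite mcoeffZ mulrA.
Qed.

Lemma gaussianX m : gaussian (mpolyX F m) = gaussian_weight m.
Proof. by rewrite /gaussian msuppX big_seq1 mcoeffX eqxx mul1r. Qed.

Lemma gaussian1 : gaussian 1 = 1.
Proof.
rewrite -mpolyX0 gaussianX /gaussian_weight big1 // => x _.
by rewrite !mnm0E eqxx.
Qed.

Lemma gaussianCM c p : gaussian (mpolyC (n + n) c * p) = c * gaussian p.
Proof. by rewrite mul_mpolyC gaussianZ. Qed.

(** On monomials this is the identity (k+1)! = (k+1) k!. *)
Lemma gaussian_by_parts x p :
  gaussian (mpolyX F (mnm1 (lshift n x)) * p) = gaussian (mderiv (rshift n x) p).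
Proof.
elim/mpolyind: p => [|c m p _ _ IH]; first by rewrite mulr0 !raddf0.
rewrite mulrDr linearD /= !raddfD /= {}IH; congr (_ + _).
rewrite -scalerAr linearZ /= !gaussianZ -mpolyXD mderivX gaussianZ !gaussianX; congr (_ * _).
rewrite /gaussian_weight (bigD1 x) //= [in RHS](bigD1 x) //= !mulrA; congr (_ * _).
  rewrite !mnmBE !mnmDE !mnm1E !(eq_rshift, eq_lshift, eq_lrshift, eq_rlshift).
  rewrite !eqxx /= subn0 add0n add1n.
  case: (m (rshift n x)) => [|k]; first by rewrite mul0r.
  rewrite eqSS subSS subn0; case: ifP => _; last by rewrite mulr0.
  by rewrite -natrM factS.
apply: eq_bigr => y; rewrite eq_sym => /negbTE xy; rewrite !mnmBE !mnmDE !mnm1E.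
by rewrite !(eq_rshift, eq_lshift, eq_lrshift, eq_rlshift) xy !subn0 !add0n.
Qed.
End GaussianFunctional.

(** * Exact quadrature for the Gaussian expectation *)

Section Quadrature.
Import -(notations) mpoly.
Variable F : numClosedFieldType.

Lemma primitive_root_exists n : (0 < n)%N -> exists z : F, n.-primitive_root z.
Proof.
move=> n_gt0; pose p : {poly F} := 'X^n - 1.
have [r Dp] := closed_field_poly_normal p.
rewrite (monicP _) ?monicXnsubC // scale1r in Dp.
have rn1: all n.-unity_root r by apply/allP=> z; rewrite -root_prod_XsubC -Dp.
have sz_r: (n < (size r).+1)%N by rewrite -(size_prod_XsubC r id) -Dp size_XnsubC.
have [|z] := hasP (cyclic.has_prim_root n_gt0 rn1 _ sz_r); last by exists z.
rewrite -separable.separable_prod_XsubC -Dp cyclotomic.separable_Xn_sub_1 //.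
by rewrite pnatr_eq0 -lt0n.
Qed.

Lemma sum_unity_root (n : nat) (x : F) : x ^+ n = 1 ->
  \sum_(k < n) x ^+ k = if x == 1 then n%:R else 0.
Proof.
move=> xn; case: eqVneq => [->|x1].
  by under eq_bigr do rewrite expr1n; rewrite sumr_const card_ord.
apply: (mulfI (x := x - 1)); first by rewrite subr_eq0.
by rewrite mulr0 -subrX1 xn subrr.
Qed.

(** The number of points does not depend on the targets tau, so that tau may be
    chosen proportional to it.  The L-th power sum is corrected by adding the L
    vertices c zeta^k of a regular polygon, whose lower power sums vanish. *)
Lemma power_sums_exist (L : nat) (tau : nat -> F) :
  exists t : 'I_(\sum_(i < L) i.+1) -> F,
    forall q, (0 < q <= L)%N -> \sum_j t j ^+ q = tau q.
Proof.
suff [s sz sE] : exists2 s : seq F, size s = (\sum_(i < L) i.+1)%N &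
    forall q, (0 < q <= L)%N -> \sum_(x <- s) x ^+ q = tau q.
  exists (fun j => s`_j) => q /sE <-.
  by rewrite -sz (big_nth 0) big_mkord.
elim: L => [|L [s sz sE]]; first by exists [::]; rewrite ?big_ord0 // => -[].
have [zeta prim] := primitive_root_exists (ltn0Sn L).
pose c := L.+1.-root ((tau L.+1 - \sum_(x <- s) x ^+ L.+1) / L.+1%:R).
exists (s ++ [seq c * zeta ^+ k | k <- iota 0 L.+1]).
  by rewrite size_cat size_map size_iota sz big_ord_recr.
move=> q /andP[q0]; rewrite big_cat big_map -[iota 0 L.+1]/(index_iota 0 L.+1) big_mkord /=.
have -> : \sum_(k < L.+1) (c * zeta ^+ k) ^+ q =
    c ^+ q * \sum_(k < L.+1) (zeta ^+ q) ^+ k.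
  by rewrite mulr_sumr; apply: eq_bigr => k _; rewrite exprMn exprAC.
rewrite sum_unity_root; last by rewrite exprAC (prim_expr_order prim) expr1n.
rewrite -(prim_order_dvd prim) leq_eqVlt => /orP[/eqP ->|].
  by rewrite dvdnn rootCK // divfK ?pnatr_eq0 // addrC subrK.
rewrite ltnS => qL; rewrite gtnNdvd // mulr0 addr0 sE // q0 //.
Qed.

(** Take z = zeta t and z' = zeta^-1 with zeta a uniform root of unity of order
    L+1, which kills the moments with p <> q, and t an independent variable with
    moments q!. *)
Lemma one_variable_quadrature (L : nat) :
  exists (J : finType) (z' z : J -> F), (0 < #|J|)%N /\
    forall p q, (p <= L)%N -> (q <= L)%N ->
      \sum_j z' j ^+ p * z j ^+ q = #|J|%:R * (if p == q then q`!%:R else 0).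
Proof.
pose K := (\sum_(i < L.+1) i.+1)%N.
have [t tE] := power_sums_exist L.+1 (fun q => K%:R * q`!%:R).
have [zeta prim] := primitive_root_exists (ltn0Sn L).
have zeta0 : zeta != 0.
  apply/eqP => z0; have := prim_expr_order prim; rewrite z0 expr0n /= => /eqP.
  by rewrite eq_sym oner_eq0.
exists ('I_L.+1 * 'I_K)%type, (fun j => zeta ^- (j.1 : 'I_L.+1)),
  (fun j => zeta ^+ (j.1 : 'I_L.+1) * t j.2).
split; first by rewrite card_prod !card_ord muln_gt0 /= /K big_ord_recl.
move=> p q pL qL.
transitivity ((\sum_(k < L.+1) (zeta ^+ q / zeta ^+ p) ^+ k) * \sum_j t j ^+ q).
  rewrite big_distrlr pair_big; apply: eq_bigr => -[k j] _ /=.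
  rewrite exprMn mulrA; congr (_ * _).
  by rewrite exprMn !exprVn mulrC -!exprM mulnC [(p * k)%N]mulnC.
have zetaX a : (zeta ^+ a) ^+ L.+1 = 1.
  by rewrite exprAC (prim_expr_order prim) expr1n.
rewrite sum_unity_root; last by rewrite expr_div_n !zetaX divr1.
have -> : (zeta ^+ q / zeta ^+ p == 1) = (p == q).
  rewrite -(inj_eq (mulIf (expf_neq0 p zeta0))) divfK ?expf_neq0 // mul1r.
  by rewrite (eq_prim_root_expr prim) !modn_small ?ltnS // eq_sym.
case: eqVneq => _; last by rewrite mul0r mulr0.
rewrite card_prod !card_ord natrM -mulrA; congr (_ * _).
case: q qL => [|q] qL; last by rewrite tE //= (leq_trans qL).
under eq_bigr do rewrite expr0.
by rewrite sumr_const card_ord fact0 mulr1.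
Qed.

Lemma gaussian_quadrature (n L : nat) :
  exists (W : finType) (v : W -> 'I_(n + n) -> F), (0 < #|W|)%N /\
    forall p : mpoly (n + n) F, (msize p <= L.+1)%N ->
      \sum_w meval (v w) p = #|W|%:R * gaussian p.
Proof.
have [J [z' [z [J0 zE]]]] := one_variable_quadrature L.
exists {ffun 'I_n -> J}, (fun (w : {ffun 'I_n -> J}) k =>
  match fintype.split k with inl x => z' (w x) | inr x => z (w x) end).
split; first by rewrite card_ffun expn_gt0 J0.
move=> p pL; rewrite [p in RHS]mpolyE raddf_sum mulr_sumr /=.
under eq_bigr do rewrite [p in meval _ p]mpolyE raddf_sum.
rewrite exchange_big; apply: eq_big_seq => m mp /=.
have mL : (mdeg m <= L)%N by rewrite -ltnS (leq_trans (msize_mdeg_lt mp)).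
have mkL k : (m k <= L)%N.
  by apply: leq_trans mL; rewrite mdegE (bigD1 k) //= leq_addr.
under eq_bigr do rewrite mevalZ mevalX.
rewrite -mulr_sumr gaussianZ gaussianX mulrCA; congr (_ * _).
rewrite /gaussian_weight card_ffun natrX.
transitivity (\sum_(w : {ffun 'I_n -> J}) \prod_(x < n)
    (z' (w x) ^+ m (lshift n x) * z (w x) ^+ m (rshift n x))).
  apply: eq_bigr => w _; rewrite big_split_ord big_split /=; congr (_ * _).
    by apply: eq_bigr => x _; rewrite (unsplitK (inl x)).
  by apply: eq_bigr => x _; rewrite (unsplitK (inr x)).
rewrite -(bigA_distr_bigA (fun x j => z' j ^+ m (lshift n x) * z j ^+ m (rshift n x))).
under eq_bigr do rewrite zE //.
by rewrite big_split /= prodr_const card_ord.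
Qed.
End Quadrature.

(** * Finite-dimensional realization *)

Lemma direct_sum_traces (F : comNzRingType) (I : Type) (s p : nat)
    (Y : 'I_p -> I -> 'M[F]_s) :
  exists Z : I -> 'M[F]_(p * s), forall w,
    \tr (\prod_(i <- w) Z i) = \sum_(k < p) \tr (\prod_(i <- w) Y k i).
Proof.
elim: p Y => [|p IH] Y.
  by exists (fun _ => 0) => w; rewrite big_ord0 /mxtrace big_ord0.
have [Z ZE] := IH (fun k => Y (lift ord0 k)).
exists (fun i => block_mx (Y ord0 i) 0 0 (Z i) : 'M[F]_(s + p * s)) => w.
rewrite big_ord_recl -ZE -(mxtrace_block _ 0 0); congr (\tr _).
elim: w => [|i w IHw]; first by rewrite !big_nil -scalar_mx_block.
rewrite !big_cons IHw -[LHS]/(_ *m _) mulmx_block.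
by rewrite !mulmx0 !mul0mx !addr0 !add0r.
Qed.

Section Realization.
Import -(notations) mpoly.
Variables (F : numClosedFieldType) (N k r : nat) (D : 'I_N -> 'M[F]_k).
Hypothesis r0 : (0 < r)%N.

Local Notation nv := (k * r)%N.
Local Notation P := (mpoly (nv + nv) F).

Let letter (x : seq 'I_N) : 'M[F]_k := \prod_(i <- x) D i.
Let c : F := r%:R^-1.
Let C : 'M[P]_(k, r) := \matrix_(i, l) mpolyX F (mnm1 (rshift nv (mxvec_index i l))).
Let C' : 'M[P]_(r, k) := \matrix_(l, i) mpolyX F (mnm1 (lshift nv (mxvec_index i l))).
Let d (i : 'I_k) (l : 'I_r) : {additive P -> P} :=
  mderiv (rshift nv (mxvec_index i l)).
Let alpha : {rmorphism F -> P} := @mpolyC (nv + nv) F.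
Let G := multitrace alpha letter c (@gaussian F nv) C C'.

Let letterM u v : letter (u ++ v) = letter u *m letter v.
Proof. by rewrite /letter big_cat. Qed.

Let cr : c * r%:R = 1.
Proof. by rewrite /c mulVf // pnatr_eq0 -lt0n. Qed.

Let dC i l i' l' : d i l (C i' l') = ((i == i') && (l == l'))%:R.
Proof.
rewrite /d /C mxE /= mderivX mnm1E eq_rshift /mxvec_index.
rewrite (inj_eq (@cast_ord_inj _ _ _)) (inj_eq enum_rank_inj).
rewrite xpair_eqE [i' == i]eq_sym [l' == l]eq_sym.
case: (boolP (_ && _)) => [/andP[/eqP -> /eqP ->]|_]; last by rewrite scale0r.
rewrite scale1r -mpolyX0; congr mpolyX; apply/mnmP => a.
by rewrite mnmBE subnn mnm0E.
Qed.

Let dC' i l i' l' : d i l (C' l' i') = 0.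
Proof. by rewrite /d /C' mxE /= mderivX mnm1E eq_lrshift scale0r. Qed.

Let loopG : loop_equations (fun x => c * \tr (letter x)) (c ^+ 2) G.
Proof.
apply: (@multitrace_loop_equations _ _ _ _ _ _ _ _ letterM cr _ d) => //.
- exact: gaussian1.
- exact: gaussianCM.
- by move=> i l p q; apply: mderivM.
- by move=> i l a; apply: mderivC.
- by move=> i l p; rewrite /C' mxE; apply: gaussian_by_parts.
Qed.

Let word_poly (w : seq 'I_N) : P := word_trace alpha letter c C C' [seq [:: i] | i <- w].

Let eval_letter (v : 'I_(nv + nv) -> F) i : 'M[F]_r :=
  c *: (map_mx (meval v) C' *m D i *m map_mx (meval v) C).

Let meval_word_poly v w :
  meval v (word_poly w) = c * \tr (\prod_(i <- w) eval_letter v i).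
Proof.
rewrite /word_poly /word_trace mevalM mevalC -trace_map_mx; congr (_ * \tr _).
elim: w => [|i w IH] /=; first by rewrite big_nil map_mx1.
rewrite big_cons map_mxM IH; congr (_ *m _).
rewrite /wishart map_mxZ !map_mxM /= mevalC; congr (_ *: (_ *m _ *m _)).
by apply/matrixP => a b; rewrite !mxE mevalC /letter big_seq1.
Qed.

(** The correlators of the Gaussian model solve the loop equations, and those of
    single words of length at most L are moments of constant matrices: a direct
    sum of the Wishart matrices at the points of a quadrature. *)
Lemma loop_equations_realized (L : nat) : exists G : seq (seq (seq 'I_N)) -> F,
  loop_equations (fun x => c * \tr (\prod_(i <- x) D i)) (c ^+ 2) G /\
      (exists (s : nat) (Y : 'I_N -> 'M[F]_s), (0 < s)%N /\
        forall w, (size w <= L)%N ->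
          \tr (\prod_(i <- w) Y i) / s%:R = G [:: [seq [:: i] | i <- w]]).
Proof.
exists G; split; first exact: loopG.
pose M := \max_(m < L.+1) \max_(w : m.-tuple 'I_N) msize (word_poly w).
have [W [v [W0 vE]]] := gaussian_quadrature F nv M.
have [Z ZE] := direct_sum_traces (fun (j : 'I_#|W|) => eval_letter (v (enum_val j))).
exists (#|W| * r)%N, Z; split=> [|w wL]; first by rewrite muln_gt0 W0.
have wM : (msize (word_poly w) <= M.+1)%N.
  apply: leqW; apply: leq_trans (leq_bigmax (Ordinal (wL : (size w < L.+1)%N))).
  exact: (leq_bigmax (in_tuple w)).
have W0' : #|W|%:R != 0 :> F by rewrite pnatr_eq0 -lt0n.
have := vE _ wM; rewrite (eq_bigr _ (fun a _ => meval_word_poly (v a) w)).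
rewrite -mulr_sumr /G /multitrace big_seq1 -/(word_poly w) => E.
apply: (mulfI W0'); rewrite -E ZE natrM invfM -/c.
rewrite mulrCA mulVKf // mulrC; congr (_ * _).
rewrite [RHS](reindex (enum_val : 'I_#|W| -> W)) //=.
exact/onW_bij/enum_val_bij.
Qed.
End Realization.

(** * The large size limit *)

Local Open Scope classical_set_scope.
Local Open Scope complex_scope.
Local Open Scope ring_scope.


Section LoopLimit.
Variables (R : realType) (I : Type).
Local Notation Co := (R[i]^o).

Lemma cvg_sum_seq (m : nat) (u : 'I_m -> nat -> Co) (l : 'I_m -> Co) :
  (forall k, u k n @[n --> \oo] --> l k) ->
  (\sum_(k < m) u k n) @[n --> \oo] --> \sum_(k < m) l k.
Proof.
elim: m u l => [|m IH] u l ul.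
  by under eq_fun do rewrite big_ord0; rewrite big_ord0; apply: cvg_cst.
under eq_fun do rewrite big_ord_recr; rewrite big_ord_recr /=.
by apply: cvgD; [apply: IH|].
Qed.

Variables (G : nat -> seq (seq (seq I)) -> Co) (tn : nat -> seq I -> Co).
Variables (e : nat -> Co) (t : seq I -> Co).
Hypothesis Gloop : forall n, loop_equations (tn n) (e n) (G n).
Hypothesis tn_cvg : forall x, tn n x @[n --> \oo] --> t x.
Hypothesis e_cvg : e n @[n --> \oo] --> (0 : Co).

(** Each term on the right of the loop equations has smaller weight than the
    left-hand side: one letter disappears and at most one word is added. *)
Let weight (ws : seq (seq (seq I))) := ((sumn (map size ws)).*2 + size ws)%N.

(** Induction on the weight: the merging terms converge, hence vanish in the limit
    because of their coefficient, and what remains is the recursion of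
    poisson_moment for the first word. *)
Lemma loop_limit ws :
  G n ws @[n --> \oo] --> (\prod_(W <- ws) poisson_moment t W : Co).
Proof.
move: ws; suff H k : forall ws, (weight ws < k)%N ->
    G n ws @[n --> \oo] --> (\prod_(W <- ws) poisson_moment t W : Co).
  move=> ws; exact: (H (weight ws).+1).
elim: k => [|k IH] ws.
  by move=> h; exfalso; rewrite ltn0 in h.
case: ws => [_|[|x W] ws wk].
- under eq_fun do rewrite (let: And3 H _ _ := Gloop _ in H).
  by rewrite big_nil; apply: cvg_cst.
- under eq_fun do rewrite (let: And3 _ H _ := Gloop _ in H).
  rewrite big_cons poisson_moment_nil mul1r; apply: IH.
  by move: wk; rewrite /weight /= add0n addnS ltnS.
under eq_fun do rewrite (let: And3 _ _ H := Gloop _ in H).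
rewrite big_cons poisson_moment_cons mulrDl -[t x * _ * _ + _]addr0.
apply: cvgD; first apply: cvgD.
- have -> : t x * poisson_moment t W * \prod_(V <- ws) poisson_moment t V =
      t x * \prod_(V <- W :: ws) poisson_moment t V by rewrite big_cons mulrA.
  apply: cvgM; [exact: tn_cvg|apply: IH].
  move: wk; rewrite /weight /= addSn doubleS; lia.
- rewrite mulr_suml; apply: cvg_sum_seq => p.
  have -> : poisson_moment t (rcons (take p W) (nth [::] W p ++ x)) *
      poisson_moment t (drop p.+1 W) * \prod_(V <- ws) poisson_moment t V =
    \prod_(V <- [:: rcons (take p W) (nth [::] W p ++ x), drop p.+1 W & ws])
      poisson_moment t V by rewrite !big_cons mulrA.
  apply: IH; move: wk; rewrite /weight /= size_rcons size_take ltn_ord size_drop.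
  have := ltn_ord p; lia.
pose l := \sum_(j < size ws) \sum_(u < size (nth [::] ws j))
  (\prod_(V <- merge_words x W (nth [::] ws j) u :: take j ws ++ drop j.+1 ws)
     poisson_moment t V : Co).
rewrite -[X in cvg_to _ (nbhs X)](mul0r l).
apply: cvgM; first exact: e_cvg.
apply: cvg_sum_seq => j; apply: cvg_sum_seq => u; apply: IH.
have Ews : sumn (map size ws) =
    (sumn (map size (take j ws ++ drop j.+1 ws)) + size (nth [::] ws j))%N.
  rewrite -[in LHS](cat_take_drop j ws) (drop_nth [::]) //.
  rewrite !map_cat !sumn_cat /=; lia.
move: wk; rewrite /weight /= Ews /merge_words !size_cat size_rcons.
rewrite !size_take !size_drop !ltn_ord.
have := ltn_ord u; have := ltn_ord j; lia.
Qed.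
End LoopLimit.

Section ConstantMatrices.
Variables (R : realType) (d : measure_display) (Omega : measurableType d).
Variables (P : probability Omega R) (m : nat).

Lemma random_matrix_cst (A : 'M[R[i]]_m) : random_matrix P (fun _ => A).
Proof.
move=> i j; split => [||p _]; last exact: Lfun_cst.
- exact: measurable_cst.
- exact: measurable_cst.
Qed.

Lemma moment_expected_trace_cst (N : nat) (A : 'I_N -> 'M[R[i]]_m) w :
  moment (@expected_trace _ _ _ P m) (fun i _ => A i) w =
  moment (@normalized_trace R m) A w.
Proof.
rewrite /moment.
have -> : \prod_(i <- w) (fun _ => A i) = (fun _ : Omega => \prod_(i <- w) A i).
  elim: w => [|i w IH]; first by rewrite !big_nil.
  by rewrite !big_cons IH.
rewrite /expected_trace /cexpectation !Rintegral_cst //.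
have -> : fine (P [set: Omega]) = 1 by rewrite (probability_setT P).
rewrite !mulr1.
by case: (normalized_trace _).
Qed.
End ConstantMatrices.

Lemma ae_exists (R : realType) (d : measure_display) (T : measurableType d)
    (P : probability T R) (Q : T -> Prop) :
  {ae P, forall x, Q x} -> exists x, Q x.
Proof.
move=> [A [mA PA0 QA]]; apply: contrapT => nQ.
have AT : A = setT.
  by rewrite -subTset => x _; apply: QA => /= Qx; apply: nQ; exists x.
by move: PA0; rewrite AT probability_setT => /eqP; rewrite eqe oner_eq0.
Qed.

Lemma cvg_real_complex (R : realType) (u : nat -> R) (l : R) :
  u n @[n --> \oo] --> l ->
  ((u n)%:C : R[i]^o) @[n --> \oo] --> (l%:C : R[i]^o).
Proof.
move=> ul; apply/cvgrPdist_lt => e e0.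
have eR : e = (complex.Re e)%:C.
  by case: e e0 => a b; rewrite ltcE /= => /andP[/eqP -> _].
have Re0 : 0 < complex.Re e by move: e0; rewrite ltcE => /andP[].
move/cvgrPdist_lt : ul => /(_ _ Re0) [k _ uk]; exists k => // n /uk /=.
rewrite eR -[l%:C - _](rmorphB (real_complex R)) normc_def /= expr0n addr0 sqrtr_sqr.
by rewrite ltcR.
Qed.

(** r_n is the least integer greater than (n + 1) / lambda. *)
Lemma ratio_exists (R : realType) (lambda : R) : 0 < lambda ->
  exists r : nat -> nat, [/\ forall n, (0 < r n)%N,
    ((r n)%:R^-1 : R) @[n --> \oo] --> 0 &
    (n.+1%:R / (r n)%:R : R) @[n --> \oo] --> lambda].
Proof.
move=> l0; pose x n : R := n.+1%:R / lambda.
pose r n := (Num.truncn (x n)).+1.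
have x0 n : 0 < x n by rewrite divr_gt0.
have r0 n : 0 < (r n)%:R :> R by rewrite ltr0n.
have xE n : n.+1%:R = lambda * x n by rewrite mulrC divfK // gt_eqF.
have xr n : x n < (r n)%:R by rewrite truncnS_gt.
have rx n : (r n)%:R <= x n + 1 by rewrite -natr1 lerD2r truncn_le // ltW.
have rV n : (r n)%:R^-1 <= lambda * harmonic n.
  rewrite /= -(invrK lambda) -invfM lef_pV2 ?posrE //; last first.
    by rewrite mulr_gt0 // ?invr_gt0.
  by rewrite mulrC; apply: ltW (xr n).
have rV0 : ((r n)%:R^-1 : R) @[n --> \oo] --> 0.
  apply: (@squeeze_cvgr _ _ _ _ (cst 0) (fun n => lambda * harmonic n) _).
  - by apply: nearW => n; rewrite invr_ge0 ler0n rV.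
  - exact: cvg_cst.
  - by rewrite -(mulr0 lambda); apply: cvgM; [exact: cvg_cst|exact: cvg_harmonic].
exists r; split => //.
apply: (@squeeze_cvgr _ _ _ _ (fun n => lambda - lambda * (r n)%:R^-1) (cst lambda) _).
- apply: nearW => n; rewrite /cst (xE n) -mulrA; apply/andP; split.
    rewrite -{1}(mulr1 lambda) -mulrBr ler_pM2l // lerBlDr.
    have -> : x n / (r n)%:R + (r n)%:R^-1 = (x n + 1) / (r n)%:R.
      by rewrite mulrDl mul1r.
    by rewrite ler_pdivlMr // mul1r.
  rewrite -[leRHS](mulr1 lambda) ler_pM2l // ler_pdivrMr // mul1r.
  exact: ltW (xr n).
- rewrite -[X in cvg_to _ (nbhs X)](_ : lambda - lambda * 0 = lambda).
    by apply: cvgB; [exact: cvg_cst|apply: cvgM; [exact: cvg_cst|]].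
  by rewrite mulr0 subr0.
- exact: cvg_cst.
Qed.

(** * Compound free Poisson laws and their matrix models *)

(** On words in the letters y the cumulants of the free algebra are lambda mu:
    both families give the moments nu in the moment-cumulant formula. *)
Lemma compound_free_poisson_exists (R : realType) (N : nat) (lambda : R)
    (mu : seq 'I_N -> R[i]) : (0 < N)%N ->
  (forall u v, mu (u ++ v) = mu (v ++ u)) ->
  compound_free_poisson lambda mu
    (fun w => poisson_moment (fun x => lambda%:C * mu x) [seq [:: i] | i <- w]).
Proof.
move=> N0 muC; set t := fun x => lambda%:C * mu x; set nu := fun w => _.
have tC u v : t (u ++ v) = t (v ++ u) by rewrite /t muC.
have [B [psi [y psiE]]] := word_functional_exists nu.
have [kappa kE] := cumulant_exists (0 : B) (fun s => psi (\prod_(x <- s) x)).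
exists B, psi, kappa, y; split => [|m b m0|chi chi0|w].
- by have := psiE [::]; rewrite big_nil.
- case: b => s sz; have sE := eqP sz; subst m.
  have -> : \prod_(k < size s) tnth (Tuple sz) k = \prod_(x <- s) x.
    by rewrite [RHS](big_nth 0) big_mkord; apply: eq_bigr => k _; rewrite (tnth_nth 0).
  rewrite kE //; apply: eq_bigr => pi _; apply: eq_bigr => V _; congr kappa.
  by apply: eq_map => k; rewrite (tnth_nth 0).
- pose i0 := Ordinal N0.
  apply: (cumulant_unique (x0 := i0) (k := fun s => kappa (map y s)) (k' := t)) => // s s0.
  rewrite -(nc_moment_map i0 0 y kappa) -kE ?size_map // big_map psiE.
  by rewrite (nc_moment_poisson _ _ tC).
- by rewrite /moment psiE.
Qed.

Lemma cvg_cyclic (R : realType) (N : nat) (D : forall n : nat, 'I_N -> 'M[R[i]]_n.+1)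
    (mu : seq 'I_N -> R[i]) :
  cvg_in_distribution (fun n => moment (@normalized_trace R n.+1) (D n)) mu ->
  forall u v, mu (u ++ v) = mu (v ++ u).
Proof.
move=> Dmu u v.
have E : (fun n => moment (@normalized_trace R n.+1) (D n) (u ++ v) : R[i]^o) =
    (fun n => moment (@normalized_trace R n.+1) (D n) (v ++ u) : R[i]^o).
  apply/funext => n; rewrite /moment /normalized_trace !big_cat /=.
  by rewrite -[LHS]/(\tr (_ *m _) / _) mxtrace_mulC.
have uv := Dmu (u ++ v); rewrite /= E in uv.
exact: (cvg_unique _ uv (Dmu (v ++ u))).
Qed.

(** The n-th matrices are exact for words of length at most n, so that each fixed
    moment eventually equals a correlator of the Gaussian model. *)
Lemma poisson_matrix_model (R : realType) (N : nat)
    (D : forall n : nat, 'I_N -> 'M[R[i]]_n.+1) (mu : seq 'I_N -> R[i]) (lambda : R) :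
  0 < lambda ->
  cvg_in_distribution (fun n => moment (@normalized_trace R n.+1) (D n)) mu ->
  exists (alpha : nat -> nat) (Z : forall n : nat, 'I_N -> 'M[R[i]]_(alpha n)),
    [/\ forall n, (0 < alpha n)%N, {homo alpha : m n / (m < n)%N} &
      cvg_in_distribution (fun n => moment (@normalized_trace R (alpha n)) (Z n))
        (fun w => poisson_moment (fun x => lambda%:C * mu x) [seq [:: i] | i <- w])].
Proof.
move=> l0 Dmu; have [r [r0 rV_cvg ratio_cvg]] := ratio_exists l0.
set t := fun x => lambda%:C * mu x.
have real n := loop_equations_realized (D n) (r0 n) n.
have [G /choice [SY GE]] : exists G : nat -> seq (seq (seq 'I_N)) -> R[i],
   forall n, exists SY : {s : nat & 'I_N -> 'M[R[i]]_s},
    [/\ loop_equations (fun x => (r n)%:R^-1 * \tr (\prod_(i <- x) D n i))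
          ((r n)%:R^-1 ^+ 2) (G n),
      (0 < projT1 SY)%N & forall w, (size w <= n)%N ->
          \tr (\prod_(i <- w) projT2 SY i) / (projT1 SY)%:R =
          G n [:: [seq [:: i] | i <- w]]].
  have [G GE] := choice real; exists G => n.
  have [Gl [s [Y [s0 YE]]]] := GE n.
  by exists (existT _ s Y); split.
pose s n := projT1 (SY n); pose Y n : 'I_N -> 'M[R[i]]_(s n) := projT2 (SY n).
have s0 n : (0 < s n)%N by have [] := GE n.
have YE n w : (size w <= n)%N ->
    \tr (\prod_(i <- w) Y n i) / (s n)%:R = G n [:: [seq [:: i] | i <- w]].
  by have [_ _] := GE n; apply.
(* enough copies of Y n make the sizes increase *)
pose fix copies n := if n is n'.+1 then (copies n' * s n').+1 else 1%N.
pose alpha n := (copies n * s n)%N.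
have copies0 n : (0 < copies n)%N by case: n.
have alpha0 n : (0 < alpha n)%N by rewrite muln_gt0 copies0 s0.
have [Z ZE] : exists Z : forall n, 'I_N -> 'M[R[i]]_(alpha n), forall n w,
    moment (@normalized_trace R (alpha n)) (Z n) w =
    \tr (\prod_(i <- w) Y n i) / (s n)%:R.
  have one n := direct_sum_traces (fun _ : 'I_(copies n) => Y n).
  exists (fun n => projT1 (cid (one n))) => n w; case: (cid (one n)) => /= Z ZE.
  rewrite /moment /normalized_trace ZE sumr_const card_ord /alpha natrM invfM.
  by rewrite -[_ *+ copies n]mulr_natl mulrACA mulfV ?mul1r // pnatr_eq0 -lt0n.
exists alpha, Z; split; [exact: alpha0| |].
  apply: homo_ltn => [|n]; first exact: ltn_trans.
  by rewrite {2}/alpha /= mulSn addnC -ltnS ltnS; have := s0 n.+1; rewrite /alpha; nia.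
have limG ws : (G n ws : R[i]^o) @[n --> \oo] --> (\prod_(W <- ws) poisson_moment t W : R[i]^o).
  apply: (@loop_limit R 'I_N G
    (fun n x => (r n)%:R^-1 * \tr (\prod_(i <- x) D n i)) (fun n => (r n)%:R^-1 ^+ 2)).
  - by move=> n; have [] := GE n.
  - move=> x.
    have -> : (fun n => (r n)%:R^-1 * \tr (\prod_(i <- x) D n i) : R[i]^o) =
      (fun n => (n.+1%:R / (r n)%:R)%:C * moment (@normalized_trace R n.+1) (D n) x).
      apply/funext => n; rewrite /moment /normalized_trace.
      rewrite rmorphM fmorphV !rmorph_nat /=.
      rewrite [n.+1%:R * _]mulrC -[RHS]mulrA; congr (_ * _).
      by rewrite mulrCA mulfV ?mulr1 // pnatr_eq0.
    by apply: cvgM; [exact: cvg_real_complex|exact: Dmu].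
  - have -> : (fun n => (r n)%:R^-1 ^+ 2 : R[i]^o) =
        (fun n => ((r n)%:R^-1)%:C * ((r n)%:R^-1)%:C).
      by apply/funext => n; rewrite fmorphV rmorph_nat expr2.
    rewrite -[X in cvg_to _ (nbhs X)](_ : 0%:C * 0%:C = 0 :> R[i]^o); last by rewrite mul0r.
    by apply: cvgM; exact: cvg_real_complex.
move=> w; have := limG [:: [seq [:: i] | i <- w]]; rewrite big_seq1; apply: cvg_trans.
apply: near_eq_cvg; near=> n; rewrite ZE YE //.
by near: n; exact: nbhs_infty_ge.
Unshelve. all: by end_near.
Qed.

Theorem theorem4p2 (R : realType) (A : cstarAlgType R) (phi : {scalar A})
    (N : nat) (a : 'I_N -> A) (lambda : R) :
  (0 < N)%N ->
  is_state phi ->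
  (forall i, self_adjoint (a i)) ->
  0 < lambda ->
  (exists (d : measure_display) (Omega : measurableType d)
          (P : probability Omega R)
          (X : forall n : nat, 'I_N -> Omega -> 'M[R[i]]_n.+1),
     almost_sure_model P X (moment phi a)) ->
  exists (alpha : nat -> nat)
         (d : measure_display) (Omega : measurableType d)
         (P : probability Omega R)
         (Y : forall n : nat, 'I_N -> Omega -> 'M[R[i]]_(alpha n)),
    [/\ forall n, (0 < alpha n)%N,
        {homo alpha : m n / (m < n)%N},
        forall n i, random_matrix P (Y n i) &
        exists2 nu : seq 'I_N -> R[i],
          compound_free_poisson lambda (moment phi a) nu &
          cvg_in_distribution
            (fun n => moment (@expected_trace _ _ _ P (alpha n)) (Y n)) nu].
Proof.
move=> N0 _ _ l0 [d] [T] [P] [X] [_ /ae_exists[omega Xmu]].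
have [alpha [Z [alpha0 alphaS Zcvg]]] := poisson_matrix_model l0 Xmu.
exists alpha, d, T, P, (fun n i _ => Z n i).
split; [exact: alpha0|exact: alphaS|move=> n i; exact: random_matrix_cst|].
exists (fun w =>
  poisson_moment (fun x => lambda%:C * moment phi a x) [seq [:: i] | i <- w]).
  exact: compound_free_poisson_exists N0 (cvg_cyclic Xmu).
move=> w; have := Zcvg w; apply: cvg_trans; apply: near_eq_cvg; apply: nearW => n.
exact/esym/moment_expected_trace_cst.
Qed.
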